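(* Let $I=[0,1]$ or $I=[0,\infty)$, and let $X$ be a Banach function space on $I$ satisfying the following hypothesis (H): either the Cesàro operator $C$ is bounded on $X$, or $X$ is a symmetric space on $[0,1]$, or $X$ is a symmetric space on $[0,\infty)$ with $CX[0,\infty)\neq\{0\}$. (1) For every $0<\lambda<m(I)$ there is a continuous embedding $CX(I)|_{[0,\lambda]}\hookrightarrow L^1(I)|_{[0,\lambda]}$. In general this fails for $\lambda=1$ if $I=[0,1]$ and for $\lambda=\infty$ if $I=[0,\infty)$; that is, there is a Banach function space $X$ on $[0,1]$ satisfying (H) with $CX[0,1]\not\hookrightarrow L^1[0,1]$, and there is a Banach function space $X$ on $[0,\infty)$ satisfying (H) with $CX[0,\infty)\not\hookrightarrow L^1[0,\infty)$. (2) If $I=[0,\infty)$, then (as sets, with equivalent norms) $$CX[0,\infty)|_{[0,1]}=C\big(X[0,\infty)|_{[0,1]}\big)\cap L^1[0,1]$$ and $$CX[0,\infty)|_{[0,\lambda]}=\big(C(X[0,\infty)|_{[0,1]})\big)|_{[0,\lambda]}\quad\text{for } 0<\lambda<1.$$ (3) If $I=[0,\infty)$ and $X$ is a symmetric space on $[0,\infty)$ with upper Boyd index $q(X)<\infty$, then $C(X[0,\infty)|_{[0,1]})\ne CX[0,\infty)|_{[0,1]}$, and $C(X[0,\infty)|_{[0,1]})$ is never a subspace of $CX[0,\infty)|_{[0,1]}$ (i.e. it is not contained in it).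
   Context: $m$ is Lebesgue measure, $L^0(I)$ the space of (a.e. classes of) real-valued Lebesgue measurable functions on $I$. A Banach function space $X$ on $I$ (also written $X(I)$) is a Banach space that is a linear subspace of $L^0(I)$ with the ideal property: $|f|\le|g|$ a.e., $f\in L^0(I)$, $g\in X$ imply $f\in X$ and $\|f\|_X\le\|g\|_X$; by convention $X$ also contains a function positive a.e. on $I$ (not assumed for derived or truncated spaces). A symmetric space is a Banach function space $X$ such that if $f,g\in L^0(I)$ are equimeasurable ($m\{|f|>s\}=m\{|g|>s\}$ for all $s>0$) and $f\in X$, then $g\in X$ and $\|f\|_X=\|g\|_X$. $X\hookrightarrow Y$ means $X\subset Y$ with continuous inclusion. $X\cap Y$ carries the norm $\max\{\|f\|_X,\|f\|_Y\}$. Cesàro operator: $Cf(x)=\frac1x\int_0^xf(t)\,dt$, $0<x\in I$. $CX(I)=\{f\in L^0(I): C|f|\in X\}$, $\|f\|_{CX}=\|C|f|\|_X$. Truncations: for a space $W$ of functions on $I$ and $A\subset I$, $W|_A$ is the space of those $f\in W$ with $\operatorname{supp}(f)\subset A$, with the norm of $W$; when $W$ is a space on $[0,\infty)$ and $A\subset[0,1]$, the elements of $W|_A$ are regarded as functions on $[0,1]$ (vanishing outside $A$), their norm being the $W$-norm of their extension by $0$ to $[0,\infty)$. In particular, $X[0,\infty)|_{[0,1]}$ is a Banach function space on $[0,1]$; $CX[0,\infty)|_{[0,1]}=\{f\in L^0[0,1]: C(|f|\chi_{[0,1]})\in X[0,\infty)\}$ with norm $\|C(|f|\chi_{[0,1]})\|_{X[0,\infty)}$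 (with $f$ extended by $0$); and $C(X[0,\infty)|_{[0,1]})=\{f\in L^0[0,1]: (C|f|)\chi_{(0,1]}\in X[0,\infty)\}$ with norm $\|(C|f|)\chi_{(0,1]}\|_{X[0,\infty)}$. Upper Boyd index on $[0,\infty)$: $q(X)=\lim_{\tau\to0^+}\frac{\ln\tau}{\ln\|\sigma_\tau\|_{X\to X}}\in[1,\infty]$, where $\sigma_\tau f(x)=f(x/\tau)$. *)

(* Defs.v *)
From HB Require Import structures.
From mathcomp Require Import all_boot all_order all_algebra.
From mathcomp Require Import all_classical all_reals all_analysis.

Set Implicit Arguments.
Unset Strict Implicit.
Unset Printing Implicit Defensive.
Import Order.TTheory GRing.Theory Num.Theory.
Import numFieldNormedType.Exports.

Local Open Scope classical_set_scope.
Local Open Scope ring_scope.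

(* R with the sigma-algebra of Lebesgue measurable sets (Caratheodory's
   construction), the domain of [completed_lebesgue_measure]. *)
Notation lebesgueTypeR R := (caratheodory_type ((@wlength R idfun)^*)%mu).

Notation leb := (@completed_lebesgue_measure _).

Section FunctionSpaces.
Variable R : realType.
Implicit Types (I A : set R) (f g : R -> R).

Definition I01 : set R := `[0, 1]%classic.
Definition Ioo : set R := `[0, +oo[%classic.

(* A class in L^0(I) is given by any of its representatives, a function on R
   whose values outside I are irrelevant. *)
Definition L0 I : set (R -> R) :=
  [set f | measurable_fun (I : set (lebesgueTypeR R)) f].

Definition ae_on I (P : R -> Prop) : Prop :=
  {ae (@completed_lebesgue_measure R), forall x, I x -> P x}.

(* A space of (classes of) functions: the functions that belong to it and their
   norm. The value of [fnorm] outside [fdom] is irrelevant. *)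
Record fspace := FSpace { fdom : set (R -> R); fnorm : (R -> R) -> R }.

Implicit Types X Y W : fspace.

Definition norm_on I X : Prop :=
  [/\ forall f, fdom X f -> 0 <= fnorm X f,
      forall f, fdom X f -> (fnorm X f = 0 <-> ae_on I (fun x => f x = 0)),
      forall (a : R) f, fdom X f ->
        fnorm X (fun x => a * f x) = `|a| * fnorm X f &
      forall f g, fdom X f -> fdom X g ->
        fnorm X (fun x => f x + g x) <= fnorm X f + fnorm X g].

Definition fspace_complete X : Prop :=
  forall u : nat -> R -> R, (forall n, fdom X (u n)) ->
  (forall e : R, 0 < e -> exists N : nat, forall m n : nat,
     (N <= m)%N -> (N <= n)%N -> fnorm X (fun x => u m x - u n x) < e) ->
  exists2 f, fdom X f &
    (fun n => fnorm X (fun x => u n x - f x)) @ \oo --> (0 : R).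

(* Applied to two a.e. equal functions f and g, the ideal property says that
   membership and norm only depend on the class of the function. *)
Definition ideal_property I X : Prop :=
  forall f g, L0 I f -> fdom X g -> ae_on I (fun x => `|f x| <= `|g x|) ->
  fdom X f /\ fnorm X f <= fnorm X g.

Definition banach_function_space I X : Prop :=
  [/\ fdom X `<=` L0 I,
      [/\ fdom X (fun=> 0),
          forall f g, fdom X f -> fdom X g -> fdom X (fun x => f x + g x) &
          forall (a : R) f, fdom X f -> fdom X (fun x => a * f x)],
      norm_on I X /\ fspace_complete X,
      ideal_property I X &
      exists2 f, fdom X f & ae_on I (fun x => 0 < f x)].

Definition equimeasurable I f g : Prop :=
  forall s : R, 0 < s ->
    leb (I `&` [set x | s < `|f x|]) = leb (I `&` [set x | s < `|g x|]).

Definition symmetric_space I X : Prop :=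
  banach_function_space I X /\
  forall f g, L0 I f -> L0 I g -> equimeasurable I f g -> fdom X f ->
    fdom X g /\ fnorm X g = fnorm X f.

(* X `-> Y with continuous inclusion *)
Definition embeds X Y : Prop :=
  fdom X `<=` fdom Y /\
  exists K : R, forall f, fdom X f -> fnorm Y f <= K * fnorm X f.

Definition same_space X Y : Prop :=
  fdom X = fdom Y /\
  exists c K : R, [/\ 0 < c, 0 < K & forall f, fdom X f ->
    c * fnorm X f <= fnorm Y f /\ fnorm Y f <= K * fnorm X f].

Definition nontrivial_on I X : Prop :=
  exists2 f, fdom X f & ~ ae_on I (fun x => f x = 0).

Definition fspaceI X Y : fspace :=
  FSpace (fdom X `&` fdom Y) (fun f => Num.max (fnorm X f) (fnorm Y f)).

Definition L1space I : fspace :=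
  FSpace [set f | leb.-integrable (I : set (lebesgueTypeR R)) (EFin \o f)]
         (fun f => fine (\int[leb]_(x in I) `|(f x)%:E|)%E).

(* Membership and norm in X of an extended real-valued function, such as C|f|
   for f not locally integrable: the function must be finite a.e. on I. *)
Definition in_fspace I X (h : R -> \bar R) : Prop :=
  ae_on I (fun x => h x \is a fin_num) /\ fdom X (fine \o h).

Definition efnorm X (h : R -> \bar R) : R := fnorm X (fine \o h).

(* Cf(x) for x > 0. If f is not integrable on [0, x] the value is infinite,
   including when both the positive and the negative part have infinite integral
   (+oo - oo is -oo in \bar R). *)
Definition cesaro_op f (x : R) : \bar R :=
  ((x^-1)%:E * \int[leb]_(t in (`[0%R, x]%classic : set (lebesgueTypeR R)))
     (f t)%:E)%E.

Definition cesaro_bounded I X : Prop :=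
  exists K : R, forall f, fdom X f ->
    in_fspace I X (cesaro_op f) /\ efnorm X (cesaro_op f) <= K * fnorm X f.

Definition cesaro_space I X : fspace :=
  FSpace [set f | L0 I f /\ in_fspace I X (cesaro_op (fun t => `|f t|))]
         (fun f => efnorm X (cesaro_op (fun t => `|f t|))).

(* W|_A as a space on I, for a space W on I and A a closed subset of I *)
Definition truncation I A W : fspace :=
  FSpace [set f | fdom W f /\ ae_on (I `\` A) (fun x => f x = 0)] (fnorm W).

(* A space of functions on [0, oo) vanishing outside [0, 1], regarded as a
   space of functions on [0, 1] through extension by 0. *)
Definition on01 W : fspace :=
  FSpace [set f | fdom W (f \_ I01)] (fun f => fnorm W (f \_ I01)).

Definition truncation01 A W : fspace := on01 (truncation Ioo A W).

Definition hypothesis_H I X : Prop :=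
  [\/ cesaro_bounded I X,
      I = I01 /\ symmetric_space I X |
      [/\ I = Ioo, symmetric_space I X & nontrivial_on I (cesaro_space I X)]].

Definition dilation (t : R) f : R -> R := fun x => f (x / t).

(* The norm of T : X -> X, infinite if T is unbounded or does not map X to X *)
Definition operator_norm X (T : (R -> R) -> R -> R) : \bar R :=
  ereal_sup [set (if `[< fdom X (T f) >] then (fnorm X (T f))%:E else +oo%E)
            | f in [set f | fdom X f /\ fnorm X f <= 1]].

(* ln t / ln ||sigma_t||, written with both signs changed so that it is +oo, as
   the convention for q(X) requires, when ||sigma_t|| = 1 (the inverse of 0 is
   +oo in \bar R; in a symmetric space 0 < ||sigma_t|| <= 1 for 0 < t < 1). *)
Definition boyd_ratio X (t : R) : \bar R :=
  ((- ln t)%:E / (- lne (operator_norm X (dilation t))))%E.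

Definition is_upper_boyd_index X (q : \bar R) : Prop :=
  boyd_ratio X t @[t --> 0^'+] --> q.

End FunctionSpaces.

Arguments I01 {R}.
Arguments Ioo {R}.

(* Main.v *)
Require Import Defs.
From HB Require Import structures.
From mathcomp Require Import all_boot all_order all_algebra.
From mathcomp Require Import all_classical all_reals all_analysis.
From mathcomp Require Import measurable_realfun lra.

Set Implicit Arguments.
Unset Strict Implicit.
Unset Printing Implicit Defensive.
Import Order.TTheory GRing.Theory Num.Theory.
Import numFieldNormedType.Exports.

Local Open Scope classical_set_scope.
Local Open Scope ring_scope.

(** Everything rests on one formula.  If f vanishes beyond lambda, then
    C|f|(x) = ||f||_1 / x for x > lambda.

    Embedding into L^1.  When the part of I beyond lambda has positive
    measure, finiteness of C|f| there forces ||f||_1 to be finite, and the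
    ideal property gives ||f||_1 ||w||_X <= ||C|f|||_X for the fixed nonzero
    function w(x) = 1/x on ]lambda, oo[ ([cesaro_L1_bound]).  For the whole
    interval the embedding fails as soon as C is bounded on X and X contains
    a function phi outside L^1.  Both hold for the functions dominated by
    multiples of a nondecreasing phi, because C phi <= phi
    ([weighted_cesaro], [weighted_not_embeds]).  The weights are
    phi = 1 / (1 - x) on [0, 1] and phi = 1 on [0, oo[.

    Truncation.  For f supported in [0, 1] the function C|f| on [0, oo[ is its
    restriction to [0, 1] plus ||f||_1 / x on ]1, oo[
    ([cesaro_restrict01_decomp]).  Hence the two spaces to be compared differ
    exactly by the integrability of f, as soon as 1/x on ]1, oo[ belongs to X.
    That is what the hypothesis on X provides ([tail1_dom]): C applied to a
    positive function decays like 1/x, and in a symmetric space the tail can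
    be translated back to ]1, oo[.  If f vanishes beyond lambda < 1, its
    integrability follows from the embedding on [0, 1].

    Finite upper Boyd index.  The function 1 / (1 - x) is not integrable on
    [0, 1], yet its Cesaro mean only has a logarithmic singularity at 1, so it
    suffices to find such a singularity in X.  If q(X) < oo, some dilation
    sigma_t with t < 1 has norm r < 1 ([strict_dilation]), provided that
    arbitrarily small dilations do not increase the norm; this follows by
    rearranging f into two copies of sigma_{1/2} f
    ([dilation_half_contraction]).  The indicators of the intervals
    [1 - t^n, 1] then have norms at most C r^n, so that their sum converges
    in X ([symmetric_majorant]), and the sum dominates the Cesaro mean of
    1 / (1 - x) up to the factor 1/t ([pole_cesaro_le]). *)

(** * Lebesgue measurable sets and affine maps *)

Notation Lmeasurable A := (measurable (A : set (lebesgueTypeR _))).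
Notation Lint A F := (\int[leb]_(x in (A : set (lebesgueTypeR _))) F x)%E.

Section LebesgueSets.
Variable R : realType.
Implicit Types (I A : set R) (f g : R -> R).

Lemma borel_Lmeasurable A :
  measurable (A : set (measurableTypeR R)) -> Lmeasurable A.
Proof. exact: sub_caratheodory. Qed.

Lemma itv_Lmeasurable (i : interval R) : Lmeasurable [set` i].
Proof. by apply: borel_Lmeasurable; exact: measurable_itv. Qed.

Lemma leb_itv (i : interval R) :
  leb [set` i] = (if i.1 < i.2 then (i.2 : \bar R) - i.1 else 0)%E.
Proof. exact: lebesgue_measure_itv. Qed.

Lemma leb_itv_bnd (a b : R) (x y : bool) : a <= b ->
  leb [set` Interval (BSide x a) (BSide y b)] = (b - a)%:E.
Proof.
rewrite leb_itv/= lte_fin le_eqVlt => /predU1P[->|->//].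
by rewrite ltxx subrr.
Qed.

Lemma leb_set1 (a : R) : leb [set a] = 0%E.
Proof. exact: lebesgue_measure_set1. Qed.

Lemma I01_Lmeasurable : Lmeasurable (I01 : set R).
Proof. exact: itv_Lmeasurable. Qed.
Lemma Ioo_Lmeasurable : Lmeasurable (Ioo : set R).
Proof. exact: itv_Lmeasurable. Qed.

(** The completed measure is the outer measure generated by interval lengths,
    so scaling can be checked on covers by half-open intervals, for arbitrary
    sets; the reverse inequality is the same fact for the inverse map. *)
Lemma leb_affine_le (a b : R) A : 0 < a ->
  (leb ((fun x => a * x + b)%R @^-1` A) <= a^-1%:E * leb A)%E.
Proof.
move=> a0; rewrite lee_pdivlMl//.
apply: le_ereal_inf_tmp => _ [F [mF AF] <-].
pose G k : set (ocitv_type R) := (fun x => a * x + b)%R @^-1` (F k).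
have GE k : measurable (G k) /\ wlength idfun (F k) = (a%:E * wlength idfun (G k))%E.
  have /ocitvP[Fk|[p p12 Fk]] : ocitv (F k) by exact: mF.
  - rewrite /G Fk preimage_set0; split => //.
    by rewrite wlength0 mule0.
  - have Gk : G k = `](a^-1 * (p.1 - b)), (a^-1 * (p.2 - b))]%classic.
      rewrite /G Fk; apply/seteqP; split=> x /=; rewrite !in_itv/= => /andP[h1 h2].
        by rewrite ltr_pdivrMl// ler_pdivlMl// ltrBlDr lerBrDr h1 h2.
      by move: h1 h2; rewrite ltr_pdivrMl// ler_pdivlMl// ltrBlDr lerBrDr => -> ->.
    split; first by rewrite Gk; exact: is_ocitv.
    have Gle : a^-1 * (p.1 - b) <= a^-1 * (p.2 - b).
      by rewrite ler_pM2l ?invr_gt0// lerD2r ltW.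
    rewrite Gk Fk (wlength_itv_bnd _ _ _ Gle) (wlength_itv_bnd _ _ _ (ltW p12)).
    rewrite -EFinM.
    by congr EFin => /=; rewrite -mulrBr mulrA divff ?gt_eqF// mul1r opprB addrA subrK.
have -> : (\sum_(0 <= k <oo) wlength idfun (F k) =
           a%:E * \sum_(0 <= k <oo) wlength idfun (G k))%E.
  rewrite -nneseriesZl//.
  by apply: eq_eseriesr => k _; exact: (GE k).2.
rewrite lee_pmul2l ?lte_fin//; apply: ereal_inf_lbound; exists G => //.
split=> [k|x /AF[k _ Fk]]; first exact: (GE k).1.
by exists k.
Qed.

Lemma leb_affine (a b : R) A : 0 < a ->
  leb ((fun x => a * x + b)%R @^-1` A) = (a^-1%:E * leb A)%E.
Proof.
move=> a0; apply/eqP; rewrite eq_le leb_affine_le//= lee_pdivrMl//.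
have ai0 : 0 < a^-1 by rewrite invr_gt0.
have := leb_affine_le (- (a^-1 * b)) ((fun x => a * x + b)%R @^-1` A) ai0.
rewrite invrK.
suff -> : (fun x => a^-1 * x - a^-1 * b)%R @^-1` ((fun x => a * x + b)%R @^-1` A) = A by [].
apply/seteqP; split => x /=;
  by rewrite -mulrBr mulrA divff ?gt_eqF// mul1r subrK.
Qed.

Lemma LmeasurableP A : Lmeasurable A <->
  forall X, leb X = (leb (X `&` A) + leb (X `&` ~` A))%E.
Proof. by []. Qed.

(** Caratheodory's criterion for the preimage of A, tested on X, is the
    criterion for A tested on the image of X. *)
Lemma Lmeasurable_affine (a b : R) A : 0 < a -> Lmeasurable A ->
  Lmeasurable ((fun x => a * x + b)%R @^-1` A).
Proof.
move=> a0 /LmeasurableP mA; apply/LmeasurableP => X.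
pose S := (fun x => a^-1 * x - a^-1 * b)%R.
have -> : X = (fun x => a * x + b)%R @^-1` (S @^-1` X).
  apply/seteqP; split => x /=; rewrite /S;
    by rewrite mulrDr mulrA mulVf ?gt_eqF// mul1r addrK.
move: (S @^-1` X) => Y.
pose T := (fun x => a * x + b)%R.
rewrite -/T preimage_setC.
rewrite -(preimage_setI T Y A) -(preimage_setI T Y (~` A)).
rewrite (leb_affine b Y a0).
rewrite (leb_affine b (Y `&` A) a0).
rewrite (leb_affine b (Y `&` ~` A) a0).
rewrite (mA Y).
by rewrite (ge0_muleDr _ (outer_measure_ge0 _ _) (outer_measure_ge0 _ _)).
Qed.

End LebesgueSets.

Arguments I01_Lmeasurable {R}.
Arguments Ioo_Lmeasurable {R}.
Arguments itv_Lmeasurable {R}.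

(** * Integrals of |f| and measurability of the Cesaro means *)

Section Integrals.
Variable R : realType.
Let aeF := ae_filter_ringOfSetsType (@completed_lebesgue_measure R).
Implicit Types (I A B : set R) (f g : R -> R) (x : R).

Lemma ae_onW I (P : R -> Prop) : (forall x, I x -> P x) -> ae_on I P.
Proof. by move=> IP; exact: aeW. Qed.

Lemma ae_on_imp I J (P Q : R -> Prop) :
  (forall x, J x -> (I x -> P x) -> Q x) -> ae_on I P -> ae_on J Q.
Proof. by move=> PQ; apply: (@filterS _ _ aeF) => x h Jx; exact: PQ. Qed.

Lemma ae_onS I (P Q : R -> Prop) : (forall x, I x -> P x -> Q x) ->
  ae_on I P -> ae_on I Q.
Proof. by move=> PQ; apply: ae_on_imp => x Ix h; apply: PQ => //; exact: h. Qed.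

Lemma ae_onS2 I (P Q S : R -> Prop) : (forall x, I x -> P x -> Q x -> S x) ->
  ae_on I P -> ae_on I Q -> ae_on I S.
Proof.
move=> PQS; apply: (@filterS2 _ _ aeF) => x hP hQ Ix.
by apply: PQS => //; [exact: hP|exact: hQ].
Qed.

Lemma ae_on_subset I J (P : R -> Prop) : J `<=` I -> ae_on I P -> ae_on J P.
Proof. by move=> JI; apply: ae_on_imp => x Jx; apply; exact: JI. Qed.

Lemma ae_on_forall I (P : nat -> R -> Prop) : (forall n, ae_on I (P n)) ->
  ae_on I (fun x => forall n, P n x).
Proof.
move=> aP; have /ae_foralln : forall n,
  {ae (@completed_lebesgue_measure R), forall x, I x -> P n x} by exact: aP.
by apply: (@filterS _ _ aeF) => x h Ix n; exact: h.
Qed.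

Lemma ae_on_exists I (P : R -> Prop) : ae_on I P -> leb I <> 0%E ->
  exists2 x, I x & P x.
Proof.
move=> aP I0; apply: contrapT => nP; apply: I0.
apply/eqP; rewrite eq_le; apply/andP; split; last exact: outer_measure_ge0.
have [A [mA A0 nPA]] := aP; rewrite -A0; apply: le_outer_measure => x Ix.
by apply: nPA => /= h; apply: nP; exists x => //; exact: h.
Qed.

Lemma ae_on_neq I x0 : ae_on I (fun x => x <> x0).
Proof.
exists [set x0]; split.
- by rewrite -set_itv1; exact: itv_Lmeasurable.
- exact: leb_set1.
- by move=> x /= h; apply: contrapT => xx0; apply: h.
Qed.

(** The L^1 norm of f over A, with the value +oo when f is not integrable. *)
Definition absint A f : \bar R := Lint A (fun t => (`|f t|)%:E).

Lemma L0_abse I f : L0 I f ->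
  measurable_fun (I : set (lebesgueTypeR R)) (fun t => (`|f t| : R)%:E).
Proof.
by move=> mf; apply/measurable_EFinP; exact: (measurableT_comp (@normr_measurable R setT)).
Qed.

Lemma L0S I A f : Lmeasurable I -> A `<=` I -> L0 I f -> L0 A f.
Proof. by move=> mI AI; exact: measurable_funS. Qed.

Lemma L0_norm I f : L0 I f -> L0 I (fun x => `|f x|).
Proof. exact: (measurableT_comp (@normr_measurable R setT)). Qed.

Lemma L0_cst I (c : R) : L0 I (fun=> c).
Proof. exact: measurable_cst. Qed.

Lemma L0D I f g : L0 I f -> L0 I g -> L0 I (fun x => f x + g x).
Proof. exact: measurable_funD. Qed.

Lemma L0B I f g : L0 I f -> L0 I g -> L0 I (fun x => f x - g x).
Proof. exact: measurable_funB. Qed.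

Lemma L0M I f g : L0 I f -> L0 I g -> L0 I (fun x => f x * g x).
Proof. exact: measurable_funM. Qed.

Lemma L0Z I (a : R) f : L0 I f -> L0 I (fun x => a * f x).
Proof. by apply: L0M; exact: L0_cst. Qed.

Lemma L0_restrict I A f : Lmeasurable I -> Lmeasurable A ->
  L0 (I `&` A) f -> L0 I (f \_ A).
Proof. by move=> mI mA; rewrite /L0/= -measurable_restrict. Qed.

Lemma L0_indic I A : Lmeasurable A -> L0 I (\1_A : R -> R).
Proof. exact: measurable_indic. Qed.

Lemma absint_ge0 A f : (0 <= absint A f)%E.
Proof. by apply: integral_ge0 => x _; rewrite lee_fin. Qed.

Lemma absint_split A B f : Lmeasurable A -> Lmeasurable B -> A `<=` B ->
  L0 B f -> absint B f = (absint A f + absint (B `\` A) f)%E.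
Proof.
move=> mA mB AB mf; rewrite -{1}(setDUK AB).
apply: (ge0_integral_setU leb mA (measurableD mB mA)).
- by rewrite (setDUK AB); exact: (L0_abse mf).
- by move=> x _; rewrite lee_fin normr_ge0.
- by rewrite disj_set2E setDIK.
Qed.

Lemma absint_subset A B f : Lmeasurable A -> Lmeasurable B -> A `<=` B ->
  L0 B f -> (absint A f <= absint B f)%E.
Proof.
move=> mA mB AB mf; apply: (ge0_subset_integral leb mA mB (L0_abse mf)) AB.
by move=> x _; rewrite lee_fin normr_ge0.
Qed.

Lemma absint_eq0 A f : Lmeasurable A -> L0 A f ->
  absint A f = 0%E <-> ae_on A (fun x => f x = 0).
Proof.
move=> mA mf; have mfE := (measurable_EFinP _ _).2 mf.
have := ae_eq_integral_abs leb mA mfE.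
rewrite -/(absint A f) => ->; split; apply: (@filterS _ _ aeF) => x h Ax.
  by have [] := h Ax.
by rewrite /cst/= h.
Qed.

Lemma absint_le A f g : Lmeasurable A -> L0 A f -> L0 A g ->
  ae_on A (fun x => `|f x| <= `|g x|) -> (absint A f <= absint A g)%E.
Proof.
move=> mA mf mg fg.
have f0 h x : A x -> (0 <= (`|h x : R|)%:E)%E by rewrite lee_fin normr_ge0.
apply: (ae_ge0_le_integral mA (f0 f) (L0_abse mf) (f0 g) (L0_abse mg)).
by apply: (@filterS _ _ aeF _ _ _ fg) => x h Ax; rewrite lee_fin; exact: h.
Qed.

Lemma absint_cst A (c : R) : Lmeasurable A ->
  absint A (fun=> c) = (`|c|%:E * leb A)%E.
Proof. by move=> mA; rewrite /absint integral_cst. Qed.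

Lemma eq_absint A f g : (forall x, A x -> f x = g x) -> absint A f = absint A g.
Proof.
by move=> fg; apply: eq_integral => x /set_mem Ax; rewrite fg.
Qed.

Lemma cesaro_absE f x :
  cesaro_op (fun t => `|f t|) x = ((x^-1)%:E * absint `[0%R, x]%classic f)%E.
Proof. by []. Qed.

(** The superlevel sets of a monotone function are intervals. *)
Lemma nondecreasing_emeasurable (F : R -> \bar R) :
  {homo F : x y / (x <= y)%R >-> (x <= y)%E} ->
  measurable_fun (setT : set (lebesgueTypeR R)) F.
Proof.
move=> ndF.
apply: (measurability (@ErealGenCInfty.G R)) => [|_ [_ [r ->] <-]].
  exact: ErealGenCInfty.measurableE.
rewrite setTI; apply: borel_Lmeasurable.
apply: is_interval_measurable => s t/=.
rewrite !in_itv/= !andbT => Fs Ft u /andP[su ut].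
by rewrite in_itv/= andbT (le_trans Fs)// ndF.
Qed.

Lemma L0_inv I : Lmeasurable I -> (forall x, I x -> 0 <= x) -> L0 I (fun x => x^-1).
Proof.
move=> mI I0.
(* The inverse is monotone only on x > 0; -oo elsewhere restores monotonicity. *)
have hm : L0 setT (fun x : R => if x > 0 then - x^-1 else 0) .
  pose E := fun x : R => if x > 0 then (- x^-1)%:E else (-oo)%E.
  have mE : measurable_fun (setT : set (lebesgueTypeR R)) E.
    apply: nondecreasing_emeasurable => x y xy; rewrite /E.
    case: ifPn => x0; last by rewrite leNye.
    rewrite (lt_le_trans x0 xy) lee_fin lerN2 lef_pV2 ?posrE//.
    exact: lt_le_trans x0 xy.
  have -> : (fun x : R => if x > 0 then - x^-1 else 0) = fine \o E.
    by apply/funext => x; rewrite /E/=; case: ifP.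
  by apply: measurableT_comp mE; exact: fine_measurable.
have := L0Z (-1) (measurable_funTS hm : L0 I _).
apply: eq_measurable_fun => x /set_mem /I0; rewrite le_eqVlt => /predU1P[<-|->].
  by rewrite ltxx invr0 mulr0.
by rewrite mulN1r opprK.
Qed.

Lemma std_Lmeasurable I : I = I01 \/ I = Ioo -> Lmeasurable I.
Proof. by case=> ->; [exact: I01_Lmeasurable|exact: Ioo_Lmeasurable]. Qed.

Lemma std_ge0 I x : I = I01 \/ I = Ioo -> I x -> 0 <= x.
Proof. by case=> ->; rewrite /I01 /Ioo/= in_itv/= => /andP[]. Qed.

Lemma std_segment I x : I = I01 \/ I = Ioo -> I x -> `[0, x]%classic `<=` I.
Proof.
case=> ->; rewrite /I01 /Ioo/= in_itv/= => /andP[x0 x1] y/=; rewrite !in_itv/=.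
  by move=> /andP[-> yx]; rewrite (le_trans yx).
by move=> /andP[-> _].
Qed.

(** Measurability of an indefinite integral is obtained from monotonicity in
    the upper end point rather than from Fubini's theorem; this covers
    integrands that are not locally integrable. *)
Lemma integral_segment_measurable I (F : R -> \bar R) : I = I01 \/ I = Ioo ->
  measurable_fun (I : set (lebesgueTypeR R)) F ->
  (forall x, 0 <= F x)%E ->
  measurable_fun (I : set (lebesgueTypeR R))
    (fun x => Lint `[0%R, x]%classic F).
Proof.
move=> hI mF F0.
pose G x := Lint `[0%R, x]%classic (F \_ I).
have mI := std_Lmeasurable hI.
have mFI : measurable_fun (setT : set (lebesgueTypeR R)) (F \_ I).
  by rewrite -measurable_restrict// setTI.
have FI0 x : (0 <= (F \_ I) x)%E by rewrite /patch; case: ifP.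
have mG : measurable_fun (setT : set (lebesgueTypeR R)) G.
  apply: nondecreasing_emeasurable => x y xy.
  apply: ge0_subset_integral => //; try exact: itv_Lmeasurable.
    exact: measurable_funTS.
  by move=> z/=; rewrite !in_itv/= => /andP[-> zx]; rewrite (le_trans zx).
have mGI : measurable_fun (I : set (lebesgueTypeR R)) G := measurable_funTS mG.
apply: eq_measurable_fun mGI => x /set_mem Ix; apply: eq_integral => t /set_mem tx.
by rewrite /patch mem_set//; exact: std_segment Ix _ tx.
Qed.

Lemma cesaro_measurable I f : I = I01 \/ I = Ioo -> L0 I f ->
  measurable_fun (I : set (lebesgueTypeR R)) (cesaro_op f).
Proof.
move=> hI mf; have mfE := (measurable_EFinP _ _).2 mf.
apply: emeasurable_funM.
  apply/measurable_EFinP; apply: L0_inv; first exact: std_Lmeasurable.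
  by move=> x; exact: std_ge0.
(* This is how the integral is defined, so it holds even when it is oo - oo. *)
rewrite (_ : (fun x => _) = (fun x => Lint `[0%R, x]%classic ((EFin \o f)^\+)
   - Lint `[0%R, x]%classic ((EFin \o f)^\-))%E); last first.
  by apply/funext => x; rewrite integralE.
by apply: emeasurable_funB; apply: integral_segment_measurable => //;
  [exact: measurable_funepos|exact: measurable_funeneg].
Qed.

Lemma L0_fine_cesaro I f : I = I01 \/ I = Ioo -> L0 I f ->
  L0 I (fine \o cesaro_op f).
Proof.
move=> hI mf; apply: (measurableT_comp (fine_measurable measurableT)).
exact: cesaro_measurable.
Qed.

End Integrals.

(** * Embedding into L^1 away from the right end point *)

Section CesaroTail.
Variable R : realType.
Implicit Types (I A B : set R) (f g : R -> R) (x : R) (X Y : fspace R).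

(** The structure behind the embedding into L^1; it is inherited by the
    truncation of X to the unit interval. *)
Definition normed_ideal I X : Prop :=
  [/\ fdom X `<=` L0 I,
      forall (a : R) f, fdom X f -> fdom X (fun x => a * f x),
      norm_on I X & ideal_property I X].

Lemma banach_normed_ideal I X : banach_function_space I X -> normed_ideal I X.
Proof. by case=> XL0 [_ _ XZ] [Xn _] Xi _; split. Qed.

Lemma absint_support I A f : Lmeasurable I -> Lmeasurable A ->
  A `<=` I -> L0 I f -> ae_on (I `\` A) (fun x => f x = 0) ->
  absint A f = absint I f.
Proof.
move=> mI mA AI mf f0; rewrite (absint_split mA mI AI mf).
have mD : Lmeasurable (I `\` A) := measurableD mI mA.
rewrite (absint_eq0 mD _).2 ?adde0//; apply: (L0S mI) mf.
by move=> x [].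
Qed.

(** The profile of C|f| beyond the support of f. *)
Definition inv_tail (lambda : R) : R -> R := fun x => x^-1 * \1_(`]lambda, +oo[) x.

Lemma inv_tail_gt lambda x : lambda < x -> inv_tail lambda x = x^-1.
Proof. by move=> h; rewrite /inv_tail indicE mem_set ?mulr1//= in_itv/= h. Qed.

Lemma inv_tail_le lambda x : x <= lambda -> inv_tail lambda x = 0.
Proof.
move=> h; rewrite /inv_tail indicE memNset ?mulr0//= in_itv/= andbT => /lt_geF.
by rewrite h.
Qed.

Lemma L0_inv_tail I lambda : I = I01 \/ I = Ioo -> L0 I (inv_tail lambda).
Proof.
move=> hI; apply: L0M.
  by apply: L0_inv => [|x]; [exact: std_Lmeasurable|exact: std_ge0].
by apply: L0_indic; exact: itv_Lmeasurable.
Qed.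

Lemma std_diff I lambda x : I = I01 \/ I = Ioo ->
  (I `\` `[0, lambda]%classic) x <-> I x /\ lambda < x.
Proof.
move=> hI; split=> [[Ix] /=|[Ix lx]].
  by rewrite in_itv/= (std_ge0 hI Ix)/= => /negP; rewrite -ltNge.
by split => //=; rewrite in_itv/= [x <= _]leNgt lx andbF.
Qed.

Lemma cesaro_tail I lambda f x : I = I01 \/ I = Ioo -> L0 I f ->
  ae_on (I `\` `[0, lambda]%classic) (fun x => f x = 0) -> I x -> lambda <= x ->
  cesaro_op (fun t => `|f t|) x = ((x^-1)%:E * absint I f)%E.
Proof.
move=> hI mf f0 Ix lx; rewrite cesaro_absE (absint_support (I := I))//.
- exact: std_Lmeasurable.
- exact: itv_Lmeasurable.
- exact: std_segment.
- apply: ae_on_subset f0 => y [Iy]; rewrite /= !in_itv/= => h; split=> //.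
  by move=> /andP[y0 yl]; apply: h; rewrite y0 (le_trans yl).
Qed.

Lemma cesaro_fine_ge0 f x : 0 <= x -> 0 <= (fine \o cesaro_op (fun t => `|f t|)) x.
Proof.
by move=> x0; apply: fine_ge0; rewrite cesaro_absE mule_ge0 ?absint_ge0// lee_fin invr_ge0.
Qed.

(** Since 1/x is a positive number, one point beyond lambda where C|f| is
    finite bounds the whole integral of |f|. *)
Lemma cesaro_tail_fin I lambda f : I = I01 \/ I = Ioo -> 0 <= lambda ->
  leb (I `\` `[0, lambda]%classic) <> 0%E -> L0 I f ->
  ae_on (I `\` `[0, lambda]%classic) (fun x => f x = 0) ->
  ae_on I (fun x => cesaro_op (fun t => `|f t|) x \is a fin_num) ->
  absint I f \is a fin_num.
Proof.
move=> hI l0 nI mf f0 cf.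
have [x /(std_diff _ _ hI)[Ix lx]] :=
  ae_on_exists (ae_on_subset (@subDsetl _ I _) cf) nI.
rewrite (cesaro_tail hI mf f0 Ix (ltW lx)).
have := absint_ge0 I f; case: (absint I f) => // _.
by rewrite gt0_muley// lte_fin invr_gt0 (le_lt_trans l0).
Qed.

Lemma cesaro_tail_le I lambda f x : I = I01 \/ I = Ioo -> 0 <= lambda -> L0 I f ->
  ae_on (I `\` `[0, lambda]%classic) (fun x => f x = 0) -> I x ->
  absint I f \is a fin_num ->
  `|fine (absint I f) * inv_tail lambda x|
    <= `|(fine \o cesaro_op (fun t => `|f t|)) x|.
Proof.
move=> hI l0 mf f0 Ix fI; have [xl|lx] := leP x lambda.
  by rewrite inv_tail_le// mulr0 normr0.
rewrite inv_tail_gt//= (cesaro_tail hI mf f0 Ix (ltW lx)).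
by rewrite -{2}(fineK fI) -EFinM/= mulrC.
Qed.

(** C|f| dominates ||f||_1 times the profile 1/x on ]lambda, oo[.  Either this
    profile lies in X, and the inverse of its norm is the constant, or no f of
    positive L^1 norm has C|f| in X. *)
Lemma cesaro_L1_bound I X lambda : I = I01 \/ I = Ioo -> normed_ideal I X ->
  0 <= lambda -> leb (I `\` `[0, lambda]%classic) <> 0%E ->
  exists2 K : R, 0 <= K & forall f, fdom (cesaro_space I X) f ->
    ae_on (I `\` `[0, lambda]%classic) (fun x => f x = 0) ->
    absint I f \is a fin_num /\
    fine (absint I f) <= K * fnorm (cesaro_space I X) f.
Proof.
move=> hI [XL0 XZ [Xn0 Xn_eq0 XnZ _] Xi] l0 nI.
pose w := inv_tail lambda.
exists (if `[< fdom X w >] then (fnorm X w)^-1 else 0).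
  by case: asboolP => // /Xn0; rewrite invr_ge0.
move=> f [mf [cf Xcf]] f0.
have fI := cesaro_tail_fin hI l0 nI mf f0 cf; split=> //.
set c := fine (absint I f).
have c_ge0 : 0 <= c by apply: fine_ge0; exact: absint_ge0.
have [cw_dom cw_norm] : fdom X (fun x => c * w x) /\
    fnorm X (fun x => c * w x) <= fnorm (cesaro_space I X) f.
  apply: Xi => //; first by apply: L0Z; exact: L0_inv_tail.
  by apply: ae_onW => x Ix; exact: cesaro_tail_le.
move: c_ge0; rewrite le_eqVlt => /predU1P[c0|c_gt0].
  by rewrite -c0 mulr_ge0//; [case: asboolP => // /Xn0; rewrite invr_ge0|exact: Xn0].
have wX : fdom X w.
  rewrite (_ : w = fun x => c^-1 * (c * w x)); first exact: XZ.
  by apply/funext => x; rewrite mulrA mulVf ?gt_eqF// mul1r.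
rewrite asboolT//.
have w_gt0 : 0 < fnorm X w.
  rewrite lt_neqAle Xn0// andbT; apply/eqP => /esym/(Xn_eq0 _ wX) w0.
  have [x /(std_diff _ _ hI)[Ix lx]] :=
    ae_on_exists (ae_on_subset (@subDsetl _ I _) w0) nI.
  by rewrite /w inv_tail_gt// => /eqP; rewrite invr_eq0 gt_eqF// (le_lt_trans l0).
by rewrite mulrC ler_pdivlMr//; move: cw_norm; rewrite XnZ// ger0_norm// ltW.
Qed.

Lemma leb_std_diff I lambda : I = I01 \/ I = Ioo -> 0 < lambda ->
  (lambda%:E < leb I)%E -> leb (I `\` `[0, lambda]%classic) <> 0%E.
Proof.
move=> hI l0 lI dI0; have mI := std_Lmeasurable hI.
have mA : Lmeasurable (`[0, lambda]%classic : set R) by exact: itv_Lmeasurable.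
move: lI; apply/negP; rewrite -leNgt.
have : (leb I <= leb (`[0%R, lambda]%classic : set R) +
    leb (I `\` `[0%R, lambda]%classic))%E.
  rewrite -measureU//; last 2 first.
  - exact: measurableD.
  - by rewrite setDIK.
  apply: le_outer_measure => x Ix.
  by have [xA|xA] := pselect (`[0, lambda]%classic x); [left|right].
by rewrite dI0 adde0 leb_itv_bnd ?subr0// ltW.
Qed.

Lemma L1_integrableP I f : Lmeasurable I -> L0 I f ->
  fdom (L1space I) f <-> absint I f \is a fin_num.
Proof.
move=> mI mf; rewrite ge0_fin_numE ?absint_ge0//; split=> [/integrableP[]//|h].
by apply/integrableP; split => //; exact/measurable_EFinP.
Qed.

Theorem cesaro_truncation_embeds_L1 I X : I = I01 \/ I = Ioo ->
  banach_function_space I X -> forall lambda, 0 < lambda ->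
  (lambda%:E < leb I)%E ->
  embeds (truncation I `[0, lambda]%classic (cesaro_space I X))
         (truncation I `[0, lambda]%classic (L1space I)).
Proof.
move=> hI bX lambda l0 lI.
have [K _ hK] := cesaro_L1_bound hI (banach_normed_ideal bX) (ltW l0)
  (leb_std_diff hI l0 lI).
split=> [f [Xf f0]|]; last by exists K => f [Xf f0]; have [] := hK _ Xf f0.
split=> //; apply/L1_integrableP; [exact: std_Lmeasurable|by case: Xf|].
by have [] := hK _ Xf f0.
Qed.

End CesaroTail.

(** * The function 1/x near infinity belongs to X *)

Section HalfLine.
Variable R : realType.
Implicit Types (I A B : set R) (f g : R -> R) (x : R) (X Y : fspace R).

Lemma L0_affine A f (a b : R) : 0 < a -> L0 A f ->
  L0 ((fun x => a * x + b) @^-1` A) (fun x => f (a * x + b)).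
Proof.
move=> a0 mf mA' B mB.
pose T := fun x => a * x + b; pose S := fun x => a^-1 * x + - (a^-1 * b).
have mA : Lmeasurable A.
  have -> : A = S @^-1` (T @^-1` A).
    apply/seteqP; split => x; rewrite /S /T /=;
      by rewrite -mulrBr mulrA divff ?gt_eqF// mul1r subrK.
  by apply: Lmeasurable_affine; rewrite ?invr_gt0.
by have := Lmeasurable_affine b a0 (mf mA B mB).
Qed.

Lemma leb_Ioo_diff lambda : 0 < lambda ->
  leb (Ioo `\` `[0, lambda]%classic : set R) <> 0%E.
Proof.
by move=> l0; apply: leb_std_diff => //; [right|rewrite leb_itv/= ltry ltry].
Qed.

(** C|f| decays no faster than the mass of f on [0, b] divided by x. *)
Lemma tail_dom X f (b : R) : normed_ideal Ioo X -> 0 < b -> L0 Ioo f ->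
  in_fspace Ioo X (cesaro_op (fun t => `|f t|)) ->
  absint `[0, b]%classic f <> 0%E -> fdom X (inv_tail b).
Proof.
move=> [XL0 XZ _ Xi] b0 mf [cf Xcf] fb0.
have hI : (Ioo : set R) = I01 \/ (Ioo : set R) = Ioo by right.
have mb : Lmeasurable (`[0, b]%classic : set R) := itv_Lmeasurable _.
have le_abs x : Ioo x -> b <= x -> (absint `[0%R, b]%classic f <= absint `[0%R, x]%classic f)%E.
  move=> Ix bx; apply: absint_subset => //; first exact: itv_Lmeasurable.
    by move=> y; rewrite /= !in_itv/= => /andP[-> yb]; rewrite (le_trans yb).
  apply: (L0S Ioo_Lmeasurable _ mf) => y; rewrite /Ioo/= !in_itv/=.
  by move=> /andP[-> _].
have fin_abs x : 0 < x -> cesaro_op (fun t => `|f t|) x \is a fin_num ->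
    absint `[0, x]%classic f \is a fin_num.
  move=> x0; rewrite cesaro_absE.
  have := absint_ge0 `[0, x]%classic f; case: (absint _ f) => // _.
  by rewrite gt0_muley// lte_fin invr_gt0.
have fbI : absint `[0, b]%classic f \is a fin_num.
  have [x /(std_diff _ _ hI)[Ix lx] cx] :=
    ae_on_exists (ae_on_subset (@subDsetl _ Ioo _) cf) (leb_Ioo_diff b0).
  rewrite ge0_fin_numE ?absint_ge0//; apply: le_lt_trans (le_abs x Ix (ltW lx)) _.
  by rewrite -ge0_fin_numE ?absint_ge0// fin_abs// (lt_trans b0).
set c := fine (absint `[0, b]%classic f).
have c_gt0 : 0 < c.
  by rewrite fine_gt0// lt0e absint_ge0 -ge0_fin_numE ?absint_ge0// fbI !andbT; apply/eqP.
suff : fdom X (fun x => c * inv_tail b x).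
  move=> /(XZ c^-1); congr (fdom X _); apply/funext => x.
  by rewrite mulrA mulVf ?gt_eqF// mul1r.
apply: (Xi _ _ _ Xcf _).1; first by apply: L0Z; exact: L0_inv_tail.
apply: ae_onS cf => x Ix cx; have [xb|bx] := leP x b.
  by rewrite inv_tail_le// mulr0 normr0.
have x0 : 0 < x by rewrite (lt_trans b0).
rewrite inv_tail_gt// (ger0_norm (cesaro_fine_ge0 f (ltW x0))) /= cesaro_absE.
rewrite -(fineK (fin_abs _ x0 cx)) -EFinM/=.
rewrite ger0_norm ?mulr_ge0 ?invr_ge0 ?(ltW x0) ?(ltW c_gt0)// mulrC.
apply: ler_wpM2l; first by rewrite invr_ge0 ltW.
by apply: fine_le; [exact: fbI|exact: fin_abs|exact: le_abs (ltW bx)].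
Qed.

(** The translate of the tail from ]b, oo[ to ]1, oo[ is equimeasurable with
    it, and 1/x <= b / (x + b - 1) for x >= 1 because (b - 1) (x - 1) >= 0. *)
Lemma tail_symmetric X (b : R) : symmetric_space Ioo X -> 1 <= b ->
  fdom X (inv_tail b) -> fdom X (inv_tail 1).
Proof.
move=> [bX symX] b1 Xb; have [_ XZ _ Xi] := banach_normed_ideal bX.
have hI : (Ioo : set R) = I01 \/ (Ioo : set R) = Ioo by right.
pose g := fun x : R => inv_tail b (1 * x + (b - 1)).
have mg : L0 Ioo g.
  have sub : Ioo `<=` (fun x => 1 * x + (b - 1)) @^-1` (Ioo : set R).
    move=> x; rewrite /Ioo/= !in_itv/= !andbT => x0.
    by rewrite mul1r addr_ge0// subr_ge0.
  have mA := Lmeasurable_affine (b - 1) ltr01 Ioo_Lmeasurable.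
  exact: (L0S mA sub (L0_affine ltr01 (L0_inv_tail b hI))).
have Xg : fdom X g.
  apply: (symX _ _ (L0_inv_tail b hI) mg _ Xb).1 => s s0.
  have -> : Ioo `&` [set x | s < `|g x|] =
    (fun x => 1 * x + (b - 1)) @^-1` (Ioo `&` [set x | s < `|inv_tail b x|]).
    apply/seteqP; split=> x [] /=; rewrite /Ioo/= !in_itv/= !andbT => x0 sg.
      by split=> //; rewrite mul1r addr_ge0// subr_ge0.
    split => //; rewrite leNgt; apply/negP => xlt0.
    move: sg; rewrite inv_tail_le ?normr0; first by move/lt_trans => /(_ _ s0); rewrite ltxx.
    by rewrite mul1r; lra.
  by rewrite leb_affine// invr1 mul1e.
apply: (Xi _ _ _ (XZ b _ Xg) _).1; first exact: L0_inv_tail.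
apply: ae_onW => x Ix; have [x1|x1] := leP x 1.
  by rewrite inv_tail_le// normr0.
rewrite (inv_tail_gt x1) /g inv_tail_gt; last by rewrite mul1r; lra.
rewrite mul1r !ger0_norm ?invr_ge0 ?mulr_ge0 ?invr_ge0//; try lra.
rewrite ler_pdivlMr ?ler_pdivrMl; try lra.
by nra.
Qed.

(** If C is bounded, it is applied to a positive element of X.  Otherwise X is
    symmetric and some f with C|f| in X is not null, hence has positive mass
    on some [0, b]. *)
Lemma tail1_dom X : banach_function_space Ioo X -> hypothesis_H Ioo X ->
  fdom X (inv_tail 1).
Proof.
move=> bX; have nX := banach_normed_ideal bX.
case=> [[K hK]|[/seteqP[/(_ 2) + _] _]|[_ symX [f [mf cf] nf]]].
- have [XL0 _ _ Xi [f Xf f0]] := bX.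
  have mf := XL0 _ Xf.
  have Xf' : fdom X (fun x => `|f x|).
    apply: (Xi _ f _ Xf _).1; first exact: L0_norm.
    by apply: ae_onW => x _; rewrite normr_id.
  have sub01 : `[0, 1]%classic `<=` (Ioo : set R).
    by move=> x; rewrite /Ioo/= !in_itv/= => /andP[-> _].
  apply: (tail_dom nX ltr01 mf (hK _ Xf').1).
  move/(absint_eq0 (itv_Lmeasurable _) (L0S Ioo_Lmeasurable sub01 mf)) => f00.
  have hF : ae_on (`[0, 1]%classic : set R) (fun=> False).
    apply: (ae_onS2 _ f00 (ae_on_subset sub01 f0)) => x _ ->.
    by rewrite ltxx.
  have n0 : leb (`[0, 1]%classic : set R) <> 0%E.
    by rewrite leb_itv_bnd// subr0 => -[] /eqP; rewrite oner_eq0.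
  by have [] := ae_on_exists hF n0.
- have h2 : (2 : R) \in `[0, +oo[ by rewrite in_itv/=; lra.
  by move=> /(_ h2); rewrite /I01/= in_itv/= => /andP[_]; lra.
- have [n fn] : exists n : nat, absint `[0, n.+1%:R]%classic f <> 0%E.
    apply: contrapT => /forallNP f0; apply: nf.
    have : ae_on Ioo (fun x => forall n : nat, x <= n.+1%:R -> f x = 0).
      apply: ae_on_forall => n; have := f0 n => /contrapT.
      move/(absint_eq0 (itv_Lmeasurable _)).
      have sub : `[0, n.+1%:R]%classic `<=` (Ioo : set R).
        by move=> x; rewrite /Ioo/= !in_itv/= => /andP[-> _].
      move=> /(_ (L0S Ioo_Lmeasurable sub mf)); apply: ae_on_imp => x Ix h xn.
      apply: h; rewrite /= in_itv/= xn andbT.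
      by move: Ix; rewrite /Ioo/= in_itv/= andbT.
    apply: ae_onS => x Ix h; apply: (h (Num.bound x)).
    move: Ix; rewrite /Ioo/= in_itv/= andbT => x0.
    by rewrite (le_trans (ltW (archi_boundP x0)))// ler_nat.
  apply: (@tail_symmetric X n.+1%:R symX); first by rewrite ler1n.
  by apply: tail_dom nX _ mf cf fn; rewrite ltr0n.
Qed.

End HalfLine.

(** * Truncation to the unit interval *)

Section UnitIntervalTruncation.
Variable R : realType.
Implicit Types (I A B : set R) (f g : R -> R) (x lambda : R) (X Y : fspace R).

Let std01 : (I01 : set R) = I01 \/ (I01 : set R) = Ioo. Proof. by left. Qed.
Let stdoo : (Ioo : set R) = I01 \/ (Ioo : set R) = Ioo. Proof. by right. Qed.

Lemma IooE x : Ioo x = (0 <= x) :> Prop.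
Proof. by rewrite /Ioo/= in_itv/= andbT. Qed.

Lemma I01E x : I01 x = (0 <= x <= 1) :> Prop.
Proof. by rewrite /I01/= in_itv. Qed.

Lemma sub_I01_Ioo : I01 `<=` (Ioo : set R).
Proof. by move=> x; rewrite I01E IooE => /andP[]. Qed.

Lemma restrict01 f x : I01 x -> (f \_ I01) x = f x.
Proof. by move=> Ix; rewrite patchE mem_set. Qed.

Lemma restrict01_out f x : ~ I01 x -> (f \_ I01) x = 0.
Proof. by move=> Ix; rewrite patchE memNset. Qed.

Lemma L0_restrict01 f : L0 Ioo (f \_ I01) <-> L0 I01 f.
Proof.
split=> [mf|mf].
  have := L0S Ioo_Lmeasurable sub_I01_Ioo mf.
  by apply: eq_measurable_fun => x /set_mem Ix; rewrite restrict01.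
apply: (L0_restrict Ioo_Lmeasurable I01_Lmeasurable).
by rewrite setIidr//; exact: sub_I01_Ioo.
Qed.

Lemma ae_on_restrict01 (P : R -> R -> Prop) f g : P 0 0 ->
  ae_on Ioo (fun x => P ((f \_ I01) x) ((g \_ I01) x)) <->
  ae_on I01 (fun x => P (f x) (g x)).
Proof.
move=> P00; split; apply: ae_on_imp => x Ix h.
  by have := h (sub_I01_Ioo Ix); rewrite !restrict01.
have [Ix1|Ix1] := pselect (I01 x); last by rewrite !restrict01_out.
by rewrite !restrict01//; exact: h.
Qed.

Lemma truncation01_dom W f :
  fdom (truncation01 I01 W) f <-> fdom W (f \_ I01).
Proof.
split=> [[]//|Wf]; split => //.
by apply: ae_onW => x [_ nIx]; rewrite restrict01_out.
Qed.

Lemma truncation01_normed_ideal X : normed_ideal Ioo X ->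
  normed_ideal I01 (truncation01 I01 X).
Proof.
move=> [XL0 XZ [Xn0 Xn_eq0 XnZ XnD] Xi].
have restrZ a f : (fun x => a * f x) \_ I01 = (fun x => a * (f \_ I01) x).
  by apply/funext => x; rewrite !patchE; case: ifP; rewrite ?mulr0.
have restrD f g : (fun x => f x + g x) \_ I01 =
    (fun x => (f \_ I01) x + (g \_ I01) x).
  by apply/funext => x; rewrite !patchE; case: ifP; rewrite ?addr0.
split.
- by move=> f /truncation01_dom /XL0 /L0_restrict01.
- move=> a f /truncation01_dom Xf; apply/truncation01_dom.
  by rewrite restrZ; exact: XZ.
- split.
  + by move=> f /truncation01_dom; exact: Xn0.
  + move=> f /truncation01_dom Xf; apply: (iff_trans (Xn_eq0 _ Xf)).
    exact: (@ae_on_restrict01 (fun a _ => a = 0) f f).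
  + move=> a f /truncation01_dom Xf; rewrite /= restrZ; exact: XnZ.
  + move=> f g /truncation01_dom Xf /truncation01_dom Xg.
    by rewrite /= restrD; exact: XnD.
- move=> f g mf /truncation01_dom Xg fg.
  have [] := Xi (f \_ I01) (g \_ I01) _ Xg _.
  + exact/L0_restrict01.
  + by apply/(@ae_on_restrict01 (fun a b => `|a| <= `|b|)).
  + by move=> Xf fgn; split=> //; apply/truncation01_dom.
Qed.

Lemma absint_restrict01 f : L0 I01 f ->
  absint Ioo (f \_ I01) = absint I01 f.
Proof.
move=> mf; rewrite -(@absint_support _ Ioo I01).
- by apply: eq_absint => x Ix; rewrite restrict01.
- exact: Ioo_Lmeasurable.
- exact: I01_Lmeasurable.
- exact: sub_I01_Ioo.
- exact/L0_restrict01.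
- by apply: ae_onW => x [_ nIx]; rewrite restrict01_out.
Qed.

Lemma cesaro_restrict01 f x : x <= 1 ->
  cesaro_op (fun t => `|(f \_ I01) t|) x = cesaro_op (fun t => `|f t|) x.
Proof.
move=> x1; rewrite !cesaro_absE; congr (_ * _)%E; apply: eq_absint => t.
rewrite /= in_itv/= => /andP[t0 tx]; rewrite restrict01// I01E t0.
exact: le_trans x1.
Qed.

Lemma cesaro_restrict01_gt1 f x : L0 I01 f -> 1 <= x ->
  cesaro_op (fun t => `|(f \_ I01) t|) x = ((x^-1)%:E * absint I01 f)%E.
Proof.
move=> mf x1; rewrite -absint_restrict01//.
apply: (cesaro_tail stdoo _ _ _ x1).
- exact/L0_restrict01.
- by apply: ae_onW => y [_ nIy]; rewrite restrict01_out.
- by rewrite IooE (le_trans _ x1).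
Qed.

(** The only effect of extending f by 0 beyond 1 is the additional tail
    ||f||_1 / x on ]1, oo[. *)
Lemma cesaro_restrict01_decomp f x : L0 I01 f -> absint I01 f \is a fin_num ->
  0 <= x ->
  (fine \o cesaro_op (fun t => `|(f \_ I01) t|)) x =
  ((fine \o cesaro_op (fun t => `|f t|)) \_ I01) x + fine (absint I01 f) * inv_tail 1 x.
Proof.
move=> mf fI x0; have [x1|x1] := leP x 1.
  by rewrite inv_tail_le// mulr0 addr0 restrict01 ?I01E ?x0//= cesaro_restrict01.
rewrite restrict01_out; last by rewrite I01E => /andP[_]; rewrite leNgt x1.
rewrite add0r inv_tail_gt//= cesaro_restrict01_gt1 ?(ltW x1)//.
by rewrite -{1}(fineK fI) -EFinM/= mulrC.
Qed.

Lemma cesaro_inner_le f x : 0 <= x ->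
  `|((fine \o cesaro_op (fun t => `|f t|)) \_ I01) x| <=
  `|(fine \o cesaro_op (fun t => `|(f \_ I01) t|)) x|.
Proof.
move=> x0; have [Ix|Ix] := pselect (I01 x); last by rewrite restrict01_out// normr0.
rewrite restrict01//= cesaro_restrict01//.
by move: Ix; rewrite I01E => /andP[].
Qed.

(** Restricting C|f| to [0, 1] decreases it, so that only the ideal property
    is involved. *)
Lemma cesaro_truncation_sub X f : normed_ideal Ioo X ->
  fdom (truncation01 I01 (cesaro_space Ioo X)) f ->
  fdom (cesaro_space I01 (truncation01 I01 X)) f /\
  fnorm (cesaro_space I01 (truncation01 I01 X)) f <=
    fnorm (truncation01 I01 (cesaro_space Ioo X)) f.
Proof.
move=> [XL0 XZ Xn Xi] /truncation01_dom[/L0_restrict01 mf [cf Xcf]].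
have [||Xf Xfn] := Xi ((fine \o cesaro_op (fun t => `|f t|)) \_ I01) _ _ Xcf.
- by apply/L0_restrict01; exact: (L0_fine_cesaro std01 (L0_norm mf)).
- by apply: ae_onW => x; rewrite IooE; exact: cesaro_inner_le.
split=> //; split => //; split; last exact/truncation01_dom.
apply: ae_on_imp cf => x Ix /(_ (sub_I01_Ioo Ix)).
by rewrite cesaro_restrict01//; move: Ix; rewrite I01E => /andP[].
Qed.

(** The missing tail of C|f| costs ||f||_1 times the norm of 1/x on
    ]1, oo[. *)
Lemma cesaro_truncation_sup X f : banach_function_space Ioo X ->
  fdom X (inv_tail 1) ->
  fdom (cesaro_space I01 (truncation01 I01 X)) f ->
  absint I01 f \is a fin_num ->
  fdom (truncation01 I01 (cesaro_space Ioo X)) f /\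
  fnorm (truncation01 I01 (cesaro_space Ioo X)) f <=
    fnorm (cesaro_space I01 (truncation01 I01 X)) f
    + fine (absint I01 f) * fnorm X (inv_tail 1).
Proof.
move=> bX Xt [mf [cf /truncation01_dom Xcf]] fI.
have [XL0 [_ XD XZ] [[Xn0 Xn_eq0 XnZ XnD] _] Xi _] := bX.
set c := fine (absint I01 f).
have c0 : 0 <= c by apply: fine_ge0; exact: absint_ge0.
pose h x := ((fine \o cesaro_op (fun t => `|f t|)) \_ I01) x + c * inv_tail 1 x.
have Xh : fdom X h by apply: XD => //; exact: XZ.
have hE x : Ioo x -> (fine \o cesaro_op (fun t => `|(f \_ I01) t|)) x = h x.
  by rewrite IooE => x0; rewrite cesaro_restrict01_decomp.
have [||XF XFn] := Xi (fine \o cesaro_op (fun t => `|(f \_ I01) t|)) _ _ Xh.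
- apply: (L0_fine_cesaro stdoo); apply: L0_norm; exact/L0_restrict01.
- by apply: ae_onW => x Ix; rewrite hE.
split; last first.
  apply: le_trans XFn _; apply: le_trans (XnD _ _ Xcf (XZ c _ Xt)) _.
  by rewrite XnZ// ger0_norm.
apply/truncation01_dom; split; first exact/L0_restrict01.
split => //; apply: ae_on_imp cf => x; rewrite IooE => x0 cf.
have [x1|x1] := leP x 1.
  by rewrite cesaro_restrict01//; apply: cf; rewrite I01E x0.
by rewrite cesaro_restrict01_gt1 ?(ltW x1)// -(fineK fI).
Qed.

Lemma leb_I01_diff lambda : 0 < lambda -> lambda < 1 ->
  leb (I01 `\` `[0, lambda]%classic : set R) <> 0%E.
Proof.
move=> l0 l1; apply: leb_std_diff => //.
by rewrite leb_itv_bnd// subr0 lte_fin.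
Qed.

Lemma cesaro_truncation_L1 X : banach_function_space Ioo X ->
  exists2 K : R, 0 <= K & forall f,
    fdom (truncation01 I01 (cesaro_space Ioo X)) f ->
    absint I01 f \is a fin_num /\
    fine (absint I01 f) <= K * fnorm (truncation01 I01 (cesaro_space Ioo X)) f.
Proof.
move=> bX; have [K K0 hK] := cesaro_L1_bound stdoo (banach_normed_ideal bX)
  ler01 (leb_Ioo_diff ltr01).
exists K => // f [Xf f0].
have mf : L0 I01 f by case: Xf => /L0_restrict01.
by have := hK _ Xf f0; rewrite absint_restrict01.
Qed.

Theorem cesaro_truncation_inter X : banach_function_space Ioo X ->
  hypothesis_H Ioo X ->
  same_space (truncation01 I01 (cesaro_space Ioo X))
             (fspaceI (cesaro_space I01 (truncation01 I01 X)) (L1space I01)).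
Proof.
move=> bX hX; have nX := banach_normed_ideal bX; have Xt := tail1_dom bX hX.
have [K K0 hK] := cesaro_truncation_L1 bX.
have t0 : 0 <= fnorm X (inv_tail 1) by case: nX => _ _ [+ _ _ _] _; exact.
split.
  apply/seteqP; split=> f.
    move=> Xf; have [Cf _] := cesaro_truncation_sub nX Xf; split => //.
    by apply/(L1_integrableP I01_Lmeasurable Cf.1); have [] := hK _ Xf.
  move=> [Cf /(L1_integrableP I01_Lmeasurable Cf.1) fI].
  by have [] := cesaro_truncation_sup bX Xt Cf fI.
exists (1 + fnorm X (inv_tail 1))^-1, (1 + K); split.
- by rewrite invr_gt0 ltr_pwDl.
- by rewrite ltr_pwDl.
move=> f Xf; have [Cf Cfn] := cesaro_truncation_sub nX Xf.
have [fI fIn] := hK _ Xf; have [_ Xfn] := cesaro_truncation_sup bX Xt Cf fI.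
split.
  rewrite ler_pdivrMl ?ltr_pwDl//; apply: le_trans Xfn _.
  rewrite mulrDl mul1r; apply: lerD; first by rewrite /= le_max lexx.
  rewrite mulrC; apply: ler_wpM2l => //.
  by rewrite /= le_max [X in _ || X]lexx orbT.
have Tf0 : 0 <= fnorm (truncation01 I01 (cesaro_space Ioo X)) f.
  have [_ _ [Xn0 _ _ _] _] := nX.
  by apply: Xn0; move/truncation01_dom : Xf => [_ []].
rewrite mulrDl mul1r [leLHS]/= ge_max; apply/andP; split.
  by apply: le_trans Cfn _; rewrite lerDl mulr_ge0.
by apply: le_trans fIn _; rewrite lerDr.
Qed.

(** Here f vanishes on ]lambda, 1], so its L^1 norm is controlled by the
    truncated space alone, through the embedding applied on [0, 1]. *)
Theorem cesaro_truncation_lt1 X lambda : banach_function_space Ioo X ->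
  hypothesis_H Ioo X -> 0 < lambda -> lambda < 1 ->
  same_space (truncation01 `[0, lambda]%classic (cesaro_space Ioo X))
     (truncation I01 `[0, lambda]%classic
        (cesaro_space I01 (truncation01 I01 X))).
Proof.
move=> bX hX l0 l1; have nX := banach_normed_ideal bX; have Xt := tail1_dom bX hX.
have nX01 := truncation01_normed_ideal nX.
have t0 : 0 <= fnorm X (inv_tail 1) by case: nX => _ _ [+ _ _ _] _; exact.
have [K K0 hK] := cesaro_L1_bound std01 nX01 (ltW l0) (leb_I01_diff l0 l1).
have suppE f : ae_on (Ioo `\` `[0, lambda]%classic) (fun x => (f \_ I01) x = 0)
    <-> ae_on (I01 `\` `[0, lambda]%classic) (fun x => f x = 0).
  split; apply: ae_on_imp => x [Ix nx] h.
    by rewrite -(restrict01 f Ix); apply: h; split=> //; exact: sub_I01_Ioo.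
  have [Ix1|Ix1] := pselect (I01 x); last by rewrite restrict01_out.
  by rewrite restrict01//; exact: h.
split.
  apply/seteqP; split=> f.
    move=> [Xf f0]; split; last exact/suppE.
    by have [] := cesaro_truncation_sub nX ((truncation01_dom _ _).2 Xf).
  move=> [Cf f0]; split; last exact/suppE.
  have [fI _] := hK _ Cf f0.
  have [Xf _] := cesaro_truncation_sup bX Xt Cf fI.
  exact/truncation01_dom.
exists (1 + K * fnorm X (inv_tail 1))^-1, 1; split => //.
- by rewrite invr_gt0 ltr_pwDl// mulr_ge0.
move=> f [/truncation01_dom Xf f0].
have [Cf Cfn] := cesaro_truncation_sub nX Xf; rewrite mul1r; split => //.
have [fI fIn] := hK _ Cf ((suppE f).1 f0).
have [_ Xfn] := cesaro_truncation_sup bX Xt Cf fI.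
rewrite ler_pdivrMl ?ltr_pwDl ?mulr_ge0//; apply: le_trans Xfn _.
rewrite mulrDl mul1r lerD2l mulrAC; exact: ler_wpM2r.
Qed.

End UnitIntervalTruncation.

(** * Weighted sup-norm spaces *)

Section WeightedSup.
Variable R : realType.
Implicit Types (I A B : set R) (f g : R -> R) (x : R) (X Y : fspace R).

Definition weight_bound I (phi f : R -> R) (K : R) : Prop :=
  0 <= K /\ ae_on I (fun x => `|f x| <= K * phi x).

(** A weighted L^oo space: the norm is the essential supremum of |f| / phi,
    written as an infimum of bounds so that no division by phi occurs. *)
Definition weighted_sup I (phi : R -> R) : fspace R :=
  FSpace [set f | L0 I f /\ exists K, weight_bound I phi f K]
         (fun f => inf [set K | weight_bound I phi f K]).

Variables (I : set R) (phi : R -> R).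
Hypotheses (stdI : I = I01 \/ I = Ioo) (mphi : L0 I phi)
  (phi_gt0 : ae_on I (fun x => 0 < phi x)).

Local Notation W := (weighted_sup I phi).
Local Notation bound := (weight_bound I phi).

Lemma natSinv_small (c e : R) : 0 < c -> 0 < e ->
  exists k : nat, k.+1%:R^-1 * c < e.
Proof.
move=> c0 e0; have /ltr_add_invr[k] : 0 < e / c by rewrite divr_gt0.
by rewrite add0r ltr_pdivlMr// => h; exists k.
Qed.

Lemma weighted_norm_le f K : bound f K -> fnorm W f <= K.
Proof. by move=> fK; apply: ge_inf => //; exists 0 => L []. Qed.

(** The infimum is attained: countably many bounds hold simultaneously almost
    everywhere. *)
Lemma weighted_norm_bound f : fdom W f -> bound f (fnorm W f).
Proof.
move=> [mf [K0 fK0]].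
have inf0 : 0 <= fnorm W f by apply: lb_le_inf; [exists K0|move=> L []].
split=> //.
have hinf : has_inf [set K | bound f K] by split; [exists K0|exists 0 => L []].
have : ae_on I (fun x => forall n : nat, `|f x| <= (fnorm W f + n.+1%:R^-1) * phi x).
  apply: ae_on_forall => n.
  have n0 : 0 < n.+1%:R^-1 :> R by rewrite invr_gt0 ltr0n.
  have [K [_ fK] KL] := inf_adherent n0 hinf.
  apply: (ae_onS2 _ fK phi_gt0) => x _ h p0; apply: le_trans h _.
  by rewrite ler_pM2r// ltW.
move=> h; apply: (ae_onS2 _ h phi_gt0) => x _ {}h p0.
rewrite leNgt; apply/negP; rewrite -subr_gt0 => d0.
have [k] := natSinv_small p0 d0; rewrite ltrBrDl -mulrDl.
by rewrite ltNge h.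
Qed.

Lemma weighted_norm_ge0 f : fdom W f -> 0 <= fnorm W f.
Proof. by move=> /weighted_norm_bound[]. Qed.

Lemma boundZ (a : R) f K : bound f K -> bound (fun x => a * f x) (`|a| * K).
Proof.
move=> [K0 fK]; split; first by rewrite mulr_ge0.
by apply: ae_onS fK => x _ h; rewrite normrM -mulrA ler_wpM2l.
Qed.

Lemma boundD f g K L : bound f K -> bound g L ->
  bound (fun x => f x + g x) (K + L).
Proof.
move=> [K0 fK] [L0 gL]; split; first exact: addr_ge0.
apply: (ae_onS2 _ fK gL) => x _ hf hg; rewrite mulrDl.
by apply: le_trans (ler_normD _ _) _; exact: lerD.
Qed.

Lemma weightedZ (a : R) f : fdom W f -> fdom W (fun x => a * f x).
Proof.
by move=> [mf [K fK]]; split; [exact: L0Z|exists (`|a| * K); exact: boundZ].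
Qed.

Lemma weightedD f g : fdom W f -> fdom W g -> fdom W (fun x => f x + g x).
Proof.
move=> [mf [K fK]] [mg [L gL]]; split; first exact: L0D.
by exists (K + L); exact: boundD.
Qed.

Lemma weightedB f g : fdom W f -> fdom W g -> fdom W (fun x => f x - g x).
Proof.
move=> Wf /(weightedZ (-1)) /(weightedD Wf); congr (fdom W _).
by apply/funext => x; rewrite mulN1r.
Qed.

Lemma weighted_norm_on : norm_on I W.
Proof.
split.
- exact: weighted_norm_ge0.
- move=> f Wf; split=> [f0|f0].
    have [_] := weighted_norm_bound Wf; rewrite f0; apply: ae_onS => x _.
    by rewrite mul0r normr_le0 => /eqP.
  apply/eqP; rewrite eq_le weighted_norm_ge0// andbT weighted_norm_le//.
  by split=> //; apply: ae_onS f0 => x _ ->; rewrite normr0 mul0r.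
- move=> a f Wf; apply/eqP; rewrite eq_le weighted_norm_le/=; last first.
    exact/boundZ/weighted_norm_bound.
  have [->|a0] := eqVneq a 0.
    by rewrite normr0 mul0r weighted_norm_ge0//; exact: weightedZ.
  rewrite -ler_pdivlMl ?normr_gt0// -normfV; apply: weighted_norm_le.
  have := boundZ a^-1 (weighted_norm_bound (weightedZ a Wf)).
  congr (bound _ _); apply/funext => x.
  by rewrite mulrA mulVf// mul1r.
- move=> f g Wf Wg; apply: weighted_norm_le.
  by apply: boundD; exact: weighted_norm_bound.
Qed.

Lemma weighted_ideal : ideal_property I W.
Proof.
move=> f g mf Wg fg.
have fb : bound f (fnorm W g).
  have [g0 gb] := weighted_norm_bound Wg; split => //.
  by apply: (ae_onS2 _ fg gb) => x _; exact: le_trans.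
by split; [split=> //; exists (fnorm W g)|exact: weighted_norm_le].
Qed.

Lemma cvg_of_rate (v : nat -> R) (N : nat -> nat) (c : R) : 0 < c ->
  (forall j m n, (N j <= m)%N -> (N j <= n)%N -> `|v m - v n| <= j.+1%:R^-1 * c) ->
  cvgn v.
Proof.
move=> c0 vN; apply/cauchy_cvgP/cauchy_exP => e e0.
have [k ke] := natSinv_small c0 e0; exists (v (N k)).
exists (N k) => // n /= kn; rewrite /ball/=.
by apply: le_lt_trans ke; exact: vN.
Qed.

(** Outside a single null set, all the countably many inequalities between the
    functions of the sequence hold, and the sequence converges pointwise at
    the rate that the norm prescribes. *)
Lemma weighted_complete : fspace_complete W.
Proof.
move=> u Wu cu.
have /choice[N hN] : forall j : nat, exists N : nat, forall m n : nat,
    (N <= m)%N -> (N <= n)%N -> fnorm W (fun x => u m x - u n x) < j.+1%:R^-1.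
  by move=> j; apply: cu; rewrite invr_gt0.
(* The upper limit is measurable everywhere on I, including the null set where
   the sequence may diverge. *)
pose f x := fine (limn_esup (fun n => (u n x)%:E)).
have mf : L0 I f.
  apply: (measurableT_comp (fine_measurable measurableT)).
  apply: measurable_fun_limn_esup => n; apply/measurable_EFinP.
  by have [] := Wu n.
have close : ae_on I (fun x => forall j m n : nat, (N j <= m)%N -> (N j <= n)%N ->
    `|u m x - u n x| <= j.+1%:R^-1 * phi x).
  apply: ae_on_forall => j; apply: ae_on_forall => m; apply: ae_on_forall => n.
  have [jm|jm] := leqP (N j) m; last exact: ae_onW.
  have [jn|jn] := leqP (N j) n; last exact: ae_onW.
  have [_ b] := weighted_norm_bound (weightedB (Wu m) (Wu n)).
  apply: (ae_onS2 _ b phi_gt0) => x _ h p0 _ _; apply: le_trans h _.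
  by rewrite ler_pM2r// ltW// hN.
have lim_close j n : (N j <= n)%N -> bound (fun x => u n x - f x) j.+1%:R^-1.
  move=> jn; split; first by rewrite invr_ge0.
  apply: (ae_onS2 _ close phi_gt0) => x _ hx p0.
  have cux : cvgn (fun n => u n x) := cvg_of_rate p0 hx.
  have fx : f x = limn (fun n => u n x).
    rewrite /f is_cvg_limn_esupE; first by rewrite (EFin_lim cux).
    apply/cvg_ex; exists (limn (fun n => u n x))%:E.
    by apply: cvg_EFin => //; exact: nearW.
  rewrite fx.
  have h : (fun m => `|u n x - u m x|) @ \oo --> `|u n x - limn (fun n => u n x)|.
    by apply: cvg_norm; apply: cvgB => //; exact: cvg_cst.
  apply: (cvgr_to_le h); exists (N j) => // m /= jm.
  exact: hx.
have Wd n : (N 0%N <= n)%N -> fdom W (fun x => u n x - f x).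
  move=> n0; split; first by apply: L0B => //; have [] := Wu n.
  by exists 1%:R^-1; exact: lim_close.
have Wf : fdom W f.
  have := weightedB (Wu (N 0%N)) (Wd _ (leqnn _)); congr (fdom W _).
  by apply/funext => x; rewrite subKr.
exists f => //; apply/cvgrPdist_lt => e e0.
have [k] := natSinv_small ltr01 e0; rewrite mulr1 => ke.
exists (maxn (N 0%N) (N k)) => // n /=; rewrite geq_max => /andP[n0 nk].
rewrite sub0r normrN (ger0_norm (weighted_norm_ge0 (Wd _ n0))).
by apply: le_lt_trans ke; apply: weighted_norm_le; exact: lim_close.
Qed.

Lemma weight_dom : fdom W phi.
Proof.
split=> //; exists 1; split=> //.
by apply: ae_onS phi_gt0 => x _ p0; rewrite gtr0_norm// mul1r.
Qed.

Lemma weighted_banach : banach_function_space I W.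
Proof.
split.
- by move=> f [].
- split; [|exact: weightedD|exact: weightedZ].
  have := weightedZ 0 weight_dom; congr (fdom W _).
  by apply/funext => x; rewrite mul0r.
- by split; [exact: weighted_norm_on|exact: weighted_complete].
- exact: weighted_ideal.
- by exists phi => //; exact: weight_dom.
Qed.

Hypothesis phi_nd : ae_on I (fun x => 0 < x /\
  forall t : R, 0 <= t -> t <= x -> phi t <= phi x).

(** For a nondecreasing weight, averaging |f| <= N phi over [0, x] gives at
    most N phi(x). *)
Lemma weighted_cesaro f : fdom W f ->
  ae_on I (fun x => (`|cesaro_op f x| <= (fnorm W f * phi x)%:E)%E).
Proof.
move=> Wf; have [f0 fb] := weighted_norm_bound Wf; set N := fnorm W f in f0 fb *.
have mf : L0 I f by case: Wf.
have mI := std_Lmeasurable stdI.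
suff : forall x, I x -> (0 < x /\ forall t : R, 0 <= t -> t <= x -> phi t <= phi x) ->
    0 < phi x -> (`|cesaro_op f x| <= (N * phi x)%:E)%E.
  by move=> h; apply: (ae_onS2 h phi_nd phi_gt0).
move=> x Ix [x0 nd] p0; rewrite /cesaro_op abseM.
have -> : `|(x^-1)%:E|%E = (x^-1)%:E by rewrite gee0_abs// lee_fin invr_ge0 ltW.
rewrite lee_pdivrMl//.
have sub := std_segment stdI Ix.
have mfx : L0 `[0, x]%classic f := L0S mI sub mf.
have := le_abse_integral leb (itv_Lmeasurable `[0, x]) ((measurable_EFinP _ _).2 mfx).
move=> /le_trans; apply.
have : (absint `[0%R, x]%classic f <= absint `[0%R, x]%classic (fun=> N * phi x)%R)%E.
  apply: absint_le => //; [exact: itv_Lmeasurable|exact: L0_cst|].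
  apply: ae_on_imp fb => t tx /(_ (sub _ tx)) ft.
  apply: le_trans ft _; rewrite [leRHS]ger0_norm ?mulr_ge0 ?(ltW p0)//.
  by move: tx; rewrite /= in_itv/= => /andP[t0 tx]; rewrite ler_wpM2l// nd.
rewrite absint_cst; last exact: itv_Lmeasurable.
rewrite leb_itv_bnd ?(ltW x0)// subr0 ger0_norm ?mulr_ge0 ?(ltW p0)//.
by rewrite muleC.
Qed.

Lemma weighted_cesaro_bounded : cesaro_bounded I W.
Proof.
exists 1 => f Wf; rewrite mul1r; have Cf := weighted_cesaro Wf.
have mf : L0 I f by case: Wf.
have Cb : bound (fine \o cesaro_op f) (fnorm W f).
  split; first exact: weighted_norm_ge0.
  apply: ae_onS Cf => x _ /=; case: (cesaro_op f x) => [r|//|//].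
  by rewrite lee_fin.
have CW : fdom W (fine \o cesaro_op f).
  by split; [exact: L0_fine_cesaro|exists (fnorm W f)].
split; last exact: weighted_norm_le.
split=> //; apply: ae_onS Cf => x _ h.
by rewrite fin_num_abs (le_lt_trans h)// ltry.
Qed.

Lemma weighted_not_embeds : absint I phi = +oo%E ->
  ~ embeds (cesaro_space I W) (L1space I).
Proof.
move=> phioo [sub _].
have : fdom (cesaro_space I W) phi.
  have [K hK] := weighted_cesaro_bounded; split=> //.
  apply: (hK _ _).1; split; first exact: L0_norm.
  have [_ [L [L0 hL]]] := weight_dom; exists L; split=> //.
  by apply: ae_onS hL => x _; rewrite normr_id.
by move=> /sub /(L1_integrableP (std_Lmeasurable stdI) mphi); rewrite phioo.
Qed.

End WeightedSup.

(** * The pole at 1 and the counterexamples *)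

Section Pole.
Variable R : realType.
Implicit Types (f : R -> R) (x t : R) (n : nat).

Definition pole x : R := (1 - x)^-1.

Lemma pole_le x y : x <= y -> y < 1 -> pole x <= pole y.
Proof.
move=> xy y1; rewrite /pole lef_pV2 ?posrE ?subr_gt0//; first by rewrite lerD2l lerN2.
exact: le_lt_trans y1.
Qed.

Lemma pole_gt0 x : x < 1 -> 0 < pole x.
Proof. by move=> x1; rewrite invr_gt0 subr_gt0. Qed.

(** As 1/0 = 0, the pole drops to 0 at 1; with the value +oo there, whose real
    part is also 0, it becomes monotone. *)
Lemma L0_pole : L0 I01 pole.
Proof.
pose E x := if x < 1 then (pole x)%:E else +oo%E.
have mE : measurable_fun (setT : set (lebesgueTypeR R)) E.
  apply: nondecreasing_emeasurable => x y xy; rewrite /E.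
  have [y1|y1] := ltP y 1; last by rewrite leey.
  by rewrite (le_lt_trans xy y1) lee_fin pole_le.
have : measurable_fun (I01 : set (lebesgueTypeR R)) (fine \o E).
  by apply: (measurableT_comp (fine_measurable measurableT)); exact: measurable_funTS.
apply: eq_measurable_fun => x /set_mem; rewrite I01E => /andP[_].
rewrite /E/= le_eqVlt => /predU1P[->|->//].
by rewrite ltxx /pole subrr invr0.
Qed.

Lemma absint_itv_bounds (a b c d : R) (p q : bool) f : a <= b ->
  L0 [set` Interval (BSide p a) (BSide q b)] f -> 0 <= c ->
  (forall x, a <= x -> x <= b -> c <= f x <= d) ->
  ((c * (b - a))%:E <= absint [set` Interval (BSide p a) (BSide q b)] f
     <= (d * (b - a))%:E)%E.
Proof.
move=> ab mf c0 cfd; have mA := itv_Lmeasurable (Interval (BSide p a) (BSide q b)).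
have cst_int e : 0 <= e ->
    absint [set` Interval (BSide p a) (BSide q b)] (fun=> e) = (e * (b - a))%:E.
  by move=> e0; rewrite absint_cst// ger0_norm// leb_itv_bnd.
have d0 : 0 <= d.
  by have /andP[h1 h2] := cfd a (lexx a) ab; rewrite (le_trans c0)// (le_trans h1).
have inab x : [set` Interval (BSide p a) (BSide q b)] x -> c <= f x <= d.
  by rewrite /= in_itv/= => /andP[/lteifW ax /lteifW xb]; exact: cfd.
rewrite -!cst_int//; apply/andP; split.
  apply: (absint_le mA (@L0_cst _ _ c) mf); apply: ae_onW => x /inab /andP[h _].
  by rewrite !ger0_norm// (le_trans c0).
apply: (absint_le mA mf (@L0_cst _ _ d)); apply: ae_onW => x /inab /andP[h h'].
by rewrite !ger0_norm// (le_trans c0).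
Qed.

(** On ]1 - t^k, 1 - t^(k+1)], of length t^k (1 - t), the pole lies between
    t^-k and t^-(k+1).  Each of these intervals thus contributes between 1 - t
    and 1/t - 1, uniformly in k: the divergence is logarithmic.  The lower
    bound gives non-integrability, the upper one controls the Cesaro mean. *)
Lemma pole_integral_bounds t n : 0 < t -> t < 1 ->
  ((n%:R * (1 - t))%:E <= absint `[0%R, (1 - t ^+ n)%R]%classic pole
    <= (n%:R * (t^-1 - 1))%:E)%E.
Proof.
move=> t0 t1; have tn k : 0 < t ^+ k <= 1.
  by rewrite exprn_gt0//= exprn_ile1// ltW.
have sub b : b <= 1 -> `[0, b]%classic `<=` (I01 : set R).
  by move=> b1 x; rewrite I01E /= in_itv/= => /andP[-> /le_trans->].
have mp b : b <= 1 -> L0 `[0, b]%classic pole.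
  by move=> /sub sb; exact: L0S I01_Lmeasurable sb L0_pole.
have b1 k : 1 - t ^+ k < 1 by rewrite gtrBl; have /andP[] := tn k.
have b0 k : 0 <= 1 - t ^+ k by rewrite subr_ge0; have /andP[] := tn k.
elim: n => [|n IH].
  rewrite !mul0r expr0 subrr.
  have := @absint_itv_bounds 0 0 0 1 true false pole (lexx 0) (mp _ ler01) (lexx 0).
  rewrite subrr !mulr0; apply => x x0 x1.
  have -> : x = 0 by apply/eqP; rewrite eq_le x0 x1.
  by rewrite /pole subr0 invr1 ler01 lexx.
set a := 1 - t ^+ n in IH *; set b := 1 - t ^+ n.+1.
have ab : a <= b.
  rewrite lerD2l lerN2 exprS; apply: ler_piMl; last exact: ltW.
  by have /andP[/ltW] := tn n.
have sab : `[0, a]%classic `<=` (`[0, b]%classic : set R).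
  by move=> x; rewrite /= !in_itv/= => /andP[-> /le_trans->].
rewrite (absint_split (itv_Lmeasurable _) (itv_Lmeasurable _) sab (mp _ (ltW (b1 _)))).
have -> : `[0, b]%classic `\` `[0, a]%classic = (`]a, b]%classic : set R).
  apply/seteqP; split=> x /=; rewrite !in_itv/=.
    by move=> [/andP[-> ->]] /negP; rewrite andTb -ltNge andbT.
  move=> /andP[ax xb]; split; first by rewrite xb andbT (le_trans (b0 n))// ltW.
  by apply/negP; rewrite negb_and -!ltNge ax orbT.
have sab' : `]a, b]%classic `<=` (I01 : set R).
  move=> x; rewrite I01E /= in_itv/= => /andP[ax xb].
  by rewrite (le_trans (b0 n) (ltW ax)) (le_trans xb (ltW (b1 _))).
have ba : b - a = t ^+ n * (1 - t).
  by rewrite /a /b exprSr; lra.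
have /andP[tn0 _] := tn n; have tn_neq0 : t ^+ n != 0 by rewrite gt_eqF.
have bnds x : a <= x -> x <= b -> (t ^+ n)^-1 <= pole x <= (t ^+ n.+1)^-1.
  move=> ax xb; have := pole_le ax (le_lt_trans xb (b1 _)).
  have := pole_le xb (b1 _).
  by rewrite /pole /a /b !opprB ![1 + _]addrC !subrK => -> ->.
have c0 : 0 <= (t ^+ n)^-1 by rewrite invr_ge0 ltW.
have := @absint_itv_bounds _ _ _ _ false false pole ab
  (L0S I01_Lmeasurable sab' L0_pole) c0 bnds.
have -> : (t ^+ n.+1)^-1 * (b - a) = t^-1 - 1.
  rewrite ba exprS invfM -mulrA [X in _ * X]mulrA mulVf// mul1r.
  by rewrite mulrBr mulr1 mulVf// gt_eqF.
rewrite ba mulrA mulVf// mul1r => /andP[h1 h2].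
move: IH => /andP[IH1 IH2]; rewrite -natr1 !mulrDl !mul1r !EFinD.
by apply/andP; split; exact: leeD.
Qed.

Lemma expr_small t (e : R) : 0 < t -> t < 1 -> 0 < e -> exists n, t ^+ n < e.
Proof.
move=> t0 t1 e0.
have /cvgrPdist_lt/(_ e e0)[n _ hn] : t ^+ n @[n --> \oo] --> 0.
  by apply: cvg_expr; rewrite ger0_norm// ltW.
exists n; have := hn n (leqnn n); rewrite sub0r normrN ger0_norm//.
by rewrite exprn_ge0// ltW.
Qed.

Lemma pole_not_integrable : absint I01 pole = +oo%E.
Proof.
apply/eqyP => A A0.
have t0 : 0 < 2^-1 :> R by rewrite invr_gt0.
have t1 : 2^-1 < 1 :> R by rewrite invf_lt1// ltr1n.
pose n := Num.bound (A * 2).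
have /andP[h _] := pole_integral_bounds n t0 t1.
have : (A%:E <= absint `[0%R, (1 - 2^-1 ^+ n)%R]%classic pole)%E.
  apply: le_trans h; rewrite lee_fin.
  have -> : 1 - 2^-1 = 2^-1 :> R by lra.
  by rewrite ler_pdivlMr// ltW// archi_boundP// mulr_ge0// ltW.
move=> /le_trans; apply.
apply: (absint_subset (itv_Lmeasurable _) I01_Lmeasurable _ L0_pole).
move=> x; rewrite I01E /= in_itv/= => /andP[-> /le_trans->//].
Qed.

Lemma I01_counterexample : exists X : fspace R,
  [/\ banach_function_space I01 X, hypothesis_H I01 X &
      ~ embeds (cesaro_space I01 X) (L1space I01)].
Proof.
have std01 : (I01 : set R) = I01 \/ (I01 : set R) = Ioo by left.
have lt1 : ae_on (I01 : set R) (fun x => x < 1).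
  apply: ae_onS (ae_on_neq I01 1) => x; rewrite I01E lt_neqAle => /andP[_ ->] x1.
  by rewrite andbT; exact/eqP.
have p0 : ae_on I01 (fun x => 0 < pole x) by apply: ae_onS lt1 => x _; exact: pole_gt0.
have nd : ae_on I01 (fun x : R => 0 < x /\
    forall t : R, 0 <= t -> t <= x -> pole t <= pole x).
  apply: (ae_onS2 _ lt1 (ae_on_neq I01 0)) => x; rewrite I01E => /andP[x0 _] x1 /eqP xn0.
  by split=> [|t _ tx]; [rewrite lt_neqAle eq_sym xn0|exact: pole_le].
exists (weighted_sup I01 pole); split.
- exact: weighted_banach L0_pole p0.
- by apply: Or31; exact: weighted_cesaro_bounded.
- by apply: weighted_not_embeds => //; [exact: L0_pole|exact: pole_not_integrable].
Qed.

Lemma Ioo_counterexample : exists X : fspace R,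
  [/\ banach_function_space Ioo X, hypothesis_H Ioo X &
      ~ embeds (cesaro_space Ioo X) (L1space Ioo)].
Proof.
have stdoo : (Ioo : set R) = I01 \/ (Ioo : set R) = Ioo by right.
have m1 : L0 Ioo (fun _ : R => 1 : R) by exact: L0_cst.
have p0 : ae_on Ioo (fun _ : R => 0 < 1 :> R) by apply: ae_onW => x _.
have nd : ae_on Ioo (fun x : R => 0 < x /\
    forall t : R, 0 <= t -> t <= x -> 1 <= 1 :> R).
  apply: ae_onS (ae_on_neq Ioo 0) => x; rewrite IooE => x0 /eqP xn0.
  by rewrite lt_neqAle eq_sym xn0.
exists (weighted_sup Ioo (fun=> 1)); split.
- exact: weighted_banach m1 p0.
- by apply: Or31; exact: weighted_cesaro_bounded.
- apply: weighted_not_embeds => //.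
  rewrite absint_cst; last exact: Ioo_Lmeasurable.
  by rewrite normr1 mul1e leb_itv/= ltry.
Qed.

End Pole.

Arguments pole {R} x.
Arguments L0_pole {R}.

(** * Dilations on a symmetric space *)

Section Dilation.
Variable R : realType.
Implicit Types (A : set R) (f g : R -> R) (x s t : R) (X : fspace R).

Definition superlevel f s : set R := [set x | s < `|f x|].

Lemma superlevel_Lmeasurable A f s : Lmeasurable A -> L0 A f ->
  Lmeasurable (A `&` superlevel f s).
Proof.
move=> mA mf; have := measurable_fun_ltr (@L0_cst _ A s) (L0_norm mf).
by move=> /(_ mA [set true]) => /(_ I).
Qed.

(** Equimeasurability can be checked piece by piece when both functions live
    on pieces of countable partitions that correspond to each other. *)
Lemma equimeasurable_pieces (P Q : nat -> set R) f g :
  (forall k, Lmeasurable (P k)) -> (forall k, Lmeasurable (Q k)) ->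
  trivIset setT P -> trivIset setT Q ->
  \bigcup_k P k = Ioo -> \bigcup_k Q k = Ioo -> L0 Ioo f -> L0 Ioo g ->
  (forall k s, 0 < s ->
    leb (P k `&` superlevel f s) = leb (Q k `&` superlevel g s)) ->
  equimeasurable Ioo f g.
Proof.
move=> mP mQ tP tQ PE QE mf mg fg s s0.
have lebE (S : nat -> set R) u : (forall k, Lmeasurable (S k)) -> trivIset setT S ->
    \bigcup_k S k = Ioo -> L0 Ioo u ->
    leb (Ioo `&` superlevel u s) = (\sum_(0 <= k <oo) leb (S k `&` superlevel u s))%E.
  move=> mS tS SE mu.
  have mSu k : Lmeasurable (S k `&` superlevel u s).
    have -> : S k `&` superlevel u s = S k `&` (Ioo `&` superlevel u s).
      by rewrite -SE setIA; congr (_ `&` _); apply/esym/setIidPl; exact: bigcup_sup.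
    by apply: measurableI => //; exact: superlevel_Lmeasurable Ioo_Lmeasurable mu.
  rewrite -SE setI_bigcupl; apply: measure_semi_bigcup => //.
  - by apply: trivIset_setIr.
  - by apply: bigcupT_measurable.
rewrite (lebE P)// (lebE Q)//; apply: eq_eseriesr => k _; exact: fg.
Qed.

Definition left_half (k : nat) : set R := `[(k.*2)%:R, (k.*2.+1)%:R[%classic.
Definition right_half (k : nat) : set R := `[(k.*2.+1)%:R, (k.*2.+2)%:R[%classic.
Definition pair_itv (k : nat) : set R := `[(k.*2)%:R, (k.*2.+2)%:R[%classic.
Definition unit_itv (k : nat) : set R := `[k%:R, k.+1%:R[%classic.

Lemma nat_dblR k : (k.*2)%:R = 2 * k%:R :> R.
Proof. by rewrite -muln2 natrM mulrC. Qed.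

Lemma pair_itvE k x : pair_itv k x = (2 * k%:R <= x < 2 * k%:R + 2) :> Prop.
Proof. by rewrite /pair_itv/= in_itv/= -addn2 natrD nat_dblR. Qed.
Lemma left_halfE k x : left_half k x = (2 * k%:R <= x < 2 * k%:R + 1) :> Prop.
Proof. by rewrite /left_half/= in_itv/= -addn1 natrD nat_dblR. Qed.
Lemma right_halfE k x : right_half k x = (2 * k%:R + 1 <= x < 2 * k%:R + 2) :> Prop.
Proof. by rewrite /right_half/= in_itv/= -addn2 -addn1 !natrD nat_dblR. Qed.
Lemma unit_itvE k x : unit_itv k x = (k%:R <= x < k%:R + 1) :> Prop.
Proof. by rewrite /unit_itv/= in_itv/= -natr1. Qed.

Lemma unit_itv_cover : \bigcup_k unit_itv k = (Ioo : set R).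
Proof.
apply/seteqP; split=> x.
  by move=> [k _]; rewrite unit_itvE IooE => /andP[/(le_trans (ler0n _ _))].
rewrite IooE => x0; exists (Num.truncn x) => //.
by rewrite unit_itvE natr1; exact: truncn_itv.
Qed.

Lemma pair_itv_cover : \bigcup_k pair_itv k = (Ioo : set R).
Proof.
apply/seteqP; split=> x.
  move=> [k _]; rewrite pair_itvE IooE => /andP[+ _]; apply: le_trans.
  by rewrite mulr_ge0.
rewrite IooE => x0; exists (Num.truncn (x / 2)) => //.
have /truncn_itv : 0 <= x / 2 by rewrite divr_ge0.
rewrite pair_itvE -[(Num.truncn _).+1%:R]natr1.
by move=> /andP[h1 h2]; apply/andP; split; lra.
Qed.

Lemma unit_itv_trivIset : trivIset setT unit_itv.
Proof.
apply/trivIsetP => i j _ _ ij; apply/seteqP; split=> x // [].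
by rewrite !unit_itvE !natr1 => /truncn_def hi /truncn_def hj; move: ij; rewrite -hi -hj eqxx.
Qed.

Lemma pair_itv_truncn k x : pair_itv k x -> Num.truncn (x / 2) = k.
Proof.
rewrite pair_itvE => /andP[h1 h2]; apply: truncn_def; rewrite -[k.+1%:R]natr1.
by apply/andP; split; lra.
Qed.

Lemma pair_itv_trivIset : trivIset setT pair_itv.
Proof.
apply/trivIsetP => i j _ _ ij; apply/seteqP; split=> x // [].
by move=> /pair_itv_truncn hi /pair_itv_truncn hj; move: ij; rewrite -hi -hj eqxx.
Qed.

(* h carries two compressed copies of f *)
(** On each half of [2k, 2k + 2[, a copy of f restricted to [2k, 2k + 2[,
    compressed by the factor 2. *)
Definition duplicate f x : R :=
  let k : R := (Num.truncn (x / 2))%:R in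
  if x < 2 * k + 1 then f (2 * x - 2 * k) else f (2 * x - (2 * k + 2)).

Definition left_copy f x : R :=
  let k : R := (Num.truncn (x / 2))%:R in
  if x < 2 * k + 1 then f (2 * x - 2 * k) else 0.

Lemma pair_halves k : pair_itv k = left_half k `|` right_half k.
Proof.
apply/seteqP; split=> x; rewrite pair_itvE /setU/= left_halfE right_halfE.
  by move=> /andP[h1 h2]; have [h|h] := ltP x (2 * k%:R + 1); [left|right]; apply/andP; split.
by case=> /andP[h1 h2]; apply/andP; split; lra.
Qed.

Lemma halves_disjoint k : left_half k `&` right_half k = set0.
Proof.
apply/seteqP; split=> x // [].
by rewrite left_halfE right_halfE => /andP[_ h1] /andP[h2 _]; lra.
Qed.

Lemma left_half_sub k : left_half k `<=` pair_itv k.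
Proof. by rewrite pair_halves; exact: subsetUl. Qed.
Lemma right_half_sub k : right_half k `<=` pair_itv k.
Proof. by rewrite pair_halves; exact: subsetUr. Qed.
Lemma pair_itv_sub k : pair_itv k `<=` Ioo.
Proof. by rewrite -pair_itv_cover; exact: bigcup_sup. Qed.

Lemma duplicate_left f k x : left_half k x -> duplicate f x = f (2 * x + - (2 * k%:R)).
Proof.
move=> hx; rewrite /duplicate (pair_itv_truncn (left_half_sub hx)).
by move: hx; rewrite left_halfE => /andP[_ ->].
Qed.
Lemma duplicate_right f k x : right_half k x ->
  duplicate f x = f (2 * x + - (2 * k%:R + 2)).
Proof.
move=> hx; rewrite /duplicate (pair_itv_truncn (right_half_sub hx)).
by move: hx; rewrite right_halfE => /andP[h _]; rewrite ltNge h.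
Qed.
Lemma left_copy_left f k x : left_half k x -> left_copy f x = f (2 * x + - (2 * k%:R)).
Proof.
move=> hx; rewrite /left_copy (pair_itv_truncn (left_half_sub hx)).
by move: hx; rewrite left_halfE => /andP[_ ->].
Qed.
Lemma left_copy_right f k x : right_half k x -> left_copy f x = 0.
Proof.
move=> hx; rewrite /left_copy (pair_itv_truncn (right_half_sub hx)).
by move: hx; rewrite right_halfE => /andP[h _]; rewrite ltNge h.
Qed.

Let lt02 : 0 < 2 :> R. Proof. by []. Qed.

Lemma left_half_preimage k x : left_half k x <-> pair_itv k (2 * x + - (2 * k%:R)).
Proof.
by rewrite left_halfE pair_itvE; split=> /andP[h1 h2]; apply/andP; split; lra.
Qed.
Lemma right_half_preimage k x : right_half k x <-> pair_itv k (2 * x + - (2 * k%:R + 2)).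
Proof.
by rewrite right_halfE pair_itvE; split=> /andP[h1 h2]; apply/andP; split; lra.
Qed.
Lemma unit_itv_preimage k x : unit_itv k x <-> pair_itv k (2 * x + 0).
Proof.
by rewrite unit_itvE pair_itvE; split=> /andP[h1 h2]; apply/andP; split; lra.
Qed.

Lemma left_half_L0 f k : L0 Ioo f ->
  L0 (left_half k) (fun x => f (2 * x + - (2 * k%:R))).
Proof.
move=> mf; apply: (L0S (Lmeasurable_affine (- (2 * k%:R)) lt02 Ioo_Lmeasurable) _
  (L0_affine lt02 mf)).
by move=> x /left_half_preimage/pair_itv_sub.
Qed.
Lemma right_half_L0 f k : L0 Ioo f ->
  L0 (right_half k) (fun x => f (2 * x + - (2 * k%:R + 2))).
Proof.
move=> mf; apply: (L0S (Lmeasurable_affine (- (2 * k%:R + 2)) lt02 Ioo_Lmeasurable) _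
  (L0_affine lt02 mf)).
by move=> x /right_half_preimage/pair_itv_sub.
Qed.

Lemma L0_halves g : (forall k, L0 (left_half k) g) -> (forall k, L0 (right_half k) g) ->
  L0 Ioo g.
Proof.
move=> hl hr; rewrite -pair_itv_cover; apply/measurable_fun_bigcup => k.
  exact: itv_Lmeasurable.
rewrite pair_halves; apply/measurable_funU; try exact: itv_Lmeasurable.
by split; [exact: hl|exact: hr].
Qed.

Lemma eq_L0 A f g : (forall x, A x -> f x = g x) -> L0 A f -> L0 A g.
Proof. by move=> fg; apply: eq_measurable_fun => x /set_mem; exact: fg. Qed.

Lemma L0_duplicate f : L0 Ioo f -> L0 Ioo (duplicate f).
Proof.
move=> mf; apply: L0_halves => k.
  by apply: (eq_L0 _ (left_half_L0 mf)) => x hx; rewrite (duplicate_left f hx).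
by apply: (eq_L0 _ (right_half_L0 mf)) => x hx; rewrite (duplicate_right f hx).
Qed.

Lemma L0_left_copy f : L0 Ioo f -> L0 Ioo (left_copy f).
Proof.
move=> mf; apply: L0_halves => k.
  by apply: (eq_L0 _ (left_half_L0 mf)) => x hx; rewrite (left_copy_left f hx).
by apply: (eq_L0 _ (@L0_cst _ _ 0)) => x hx; rewrite (left_copy_right f hx).
Qed.

Lemma dilation_halfE f : dilation 2^-1 f = fun x => f (2 * x + 0).
Proof. by apply/funext => x; rewrite /dilation invrK addr0 mulrC. Qed.

Lemma L0_dilation_half f : L0 Ioo f -> L0 Ioo (dilation 2^-1 f).
Proof.
move=> mf; rewrite dilation_halfE.
apply: (L0S (Lmeasurable_affine 0 lt02 Ioo_Lmeasurable) _ (L0_affine lt02 mf)).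
by move=> x; rewrite /preimage/= !IooE addr0 => x0; rewrite mulr_ge0.
Qed.

(** A piece on which g is f compressed by 2 carries half of the distribution
    of f. *)
Lemma leb_piece (T P : set R) f g (b s : R) :
  (forall x, P x <-> T (2 * x + b)) -> (forall x, P x -> g x = f (2 * x + b)) ->
  leb (P `&` superlevel g s) = (2^-1%:E * leb (T `&` superlevel f s))%E.
Proof.
move=> PT gf; rewrite -(leb_affine b _ lt02); congr (leb _).
apply/seteqP; split=> x [] /=.
  by move=> Px; rewrite /superlevel/= gf// => h; split=> //; apply/PT.
by move=> Tx h; have Px := (PT x).2 Tx; split=> //; rewrite /superlevel/= gf.
Qed.

(** Two copies, each with half of the distribution. *)
Lemma duplicate_equimeasurable f : L0 Ioo f -> equimeasurable Ioo f (duplicate f).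
Proof.
move=> mf; have mP k : Lmeasurable (pair_itv k) by exact: itv_Lmeasurable.
apply: (equimeasurable_pieces mP mP pair_itv_trivIset pair_itv_trivIset
  pair_itv_cover pair_itv_cover mf (L0_duplicate mf)) => k s s0.
have mg := L0_duplicate mf.
have lebU : leb (left_half k `&` superlevel (duplicate f) s `|`
      right_half k `&` superlevel (duplicate f) s) =
    (leb (left_half k `&` superlevel (duplicate f) s) +
     leb (right_half k `&` superlevel (duplicate f) s))%E.
  apply: measureU.
  - apply: superlevel_Lmeasurable; first exact: itv_Lmeasurable.
    exact: L0S Ioo_Lmeasurable (subset_trans (@left_half_sub k) (@pair_itv_sub k)) mg.
  - apply: superlevel_Lmeasurable; first exact: itv_Lmeasurable.
    exact: L0S Ioo_Lmeasurable (subset_trans (@right_half_sub k) (@pair_itv_sub k)) mg.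
  - by rewrite setIACA halves_disjoint set0I.
rewrite [in RHS]pair_halves setIUl lebU.
rewrite (leb_piece s (@left_half_preimage k) (@duplicate_left f k)).
rewrite (leb_piece s (@right_half_preimage k) (@duplicate_right f k)).
rewrite -ge0_muleDl ?lee_fin ?invr_ge0// -EFinD.
have -> : 2^-1 + 2^-1 = 1 :> R by lra.
by rewrite mul1e.
Qed.

(** The copies on the left halves, put side by side, form f(2x). *)
Lemma left_copy_equimeasurable f : L0 Ioo f ->
  equimeasurable Ioo (left_copy f) (dilation 2^-1 f).
Proof.
move=> mf; have mP k : Lmeasurable (pair_itv k) by exact: itv_Lmeasurable.
have mQ k : Lmeasurable (unit_itv k) by exact: itv_Lmeasurable.
apply: (equimeasurable_pieces mP mQ pair_itv_trivIset unit_itv_trivIset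
  pair_itv_cover unit_itv_cover (L0_left_copy mf) (L0_dilation_half mf)) => k s s0.
have -> : pair_itv k `&` superlevel (left_copy f) s =
    left_half k `&` superlevel (left_copy f) s.
  rewrite pair_halves setIUl; apply/setUidPl => x [hx].
  by rewrite /superlevel/= (left_copy_right f hx) normr0 ltNge ltW.
rewrite (leb_piece s (@left_half_preimage k) (@left_copy_left f k)).
by rewrite (leb_piece s (@unit_itv_preimage k) (f := f))// dilation_halfE.
Qed.

(** f(2x) is equimeasurable with one of the two copies of f that form a
    rearrangement of f, and is therefore at most as large in norm.  Working
    with f itself, instead of its decreasing rearrangement, avoids any
    assumption on the decay of f at infinity. *)
Lemma dilation_half_contraction X f : symmetric_space Ioo X -> fdom X f ->
  fdom X (dilation 2^-1 f) /\ fnorm X (dilation 2^-1 f) <= fnorm X f.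
Proof.
move=> [bX symX] Xf; have [XL0 _ _ Xi] := banach_normed_ideal bX.
have mf := XL0 _ Xf.
have [Xd Xdn] := symX _ _ mf (L0_duplicate mf) (duplicate_equimeasurable mf) Xf.
have [||Xl Xln] := Xi (left_copy f) (duplicate f) _ Xd.
- exact: L0_left_copy.
- apply: ae_onW => x _; rewrite /left_copy /duplicate.
  by case: ifP => _ //; rewrite normr0.
have [Xs Xsn] := symX _ _ (L0_left_copy mf) (L0_dilation_half mf)
  (left_copy_equimeasurable mf) Xl.
by split=> //; rewrite Xsn -Xdn.
Qed.

Lemma dilation_pow_contraction X k f : symmetric_space Ioo X -> fdom X f ->
  fdom X (dilation (2^-1 ^+ k) f) /\ fnorm X (dilation (2^-1 ^+ k) f) <= fnorm X f.
Proof.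
move=> sX Xf; elim: k => [|k [Xk Xkn]].
  rewrite expr0; suff -> : dilation 1 f = f by [].
  by apply/funext => x; rewrite /dilation divr1.
have -> : dilation (2^-1 ^+ k.+1) f = dilation 2^-1 (dilation (2^-1 ^+ k) f).
  by apply/funext => x; rewrite /dilation exprSr invfM mulrAC mulrA.
have [Xd Xdn] := dilation_half_contraction sX Xk.
by split=> //; exact: le_trans Xdn Xkn.
Qed.

End Dilation.

(** * Finite upper Boyd index *)

Section FiniteBoydIndex.
Variable R : realType.
Implicit Types (A B : set R) (f g : R -> R) (x s t r : R) (X : fspace R).

Lemma operator_norm_le1 X k : symmetric_space Ioo X ->
  (operator_norm X (dilation (2^-1 ^+ k)) <= 1)%E.
Proof.
move=> sX; apply: ge_ereal_sup => _ [f [Xf fn] <-].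
have [Xd Xdn] := dilation_pow_contraction k sX Xf.
by rewrite asboolT// lee_fin (le_trans Xdn).
Qed.

(** A norm equal to 1 would make the Boyd ratio +oo, which is excluded for
    small t since q is finite.  Only t = 2^-k is used, where the norm is known
    to be at most 1. *)
Lemma strict_dilation X (q : \bar R) : symmetric_space Ioo X ->
  is_upper_boyd_index X q -> (q < +oo)%E ->
  exists t r : R, [/\ 0 < t < 1, 0 <= r < 1 &
    forall f, fdom X f -> fdom X (dilation t f) /\
      fnorm X (dilation t f) <= r * fnorm X f].
Proof.
move=> sX hq qoo; have [bX _] := sX.
have [_ [X0 _ XZ] [[Xn0 Xn_eq0 XnZ XnD] _] _ _] := bX.
have [d d0 hd] : exists2 d : R, 0 < d & forall t, 0 < t -> t < d ->
    (boyd_ratio X t < +oo)%E.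
  have : nbhs q [set y | (y < +oo)%E].
    by apply: open_nbhs_nbhs; split => //; exact: open_ereal_lt_ereal.
  move=> /hq [e /= e0 he]; exists e => // t t0 te.
  by apply: he => //=; rewrite sub0r normrN ger0_norm ?ltW.
have h0 : 0 < 2^-1 :> R by rewrite invr_gt0.
have h1 : 2^-1 < 1 :> R by rewrite invf_lt1// ltr1n.
have m0 : 0 < Num.min d 1 by rewrite lt_min d0 ltr01.
have [k] := expr_small h0 h1 m0; rewrite lt_min => /andP[kd k1].
set t := 2^-1 ^+ k in kd k1; have t0 : 0 < t by rewrite exprn_gt0.
set M := operator_norm X (dilation t).
have M_ub f : fdom X f -> fnorm X f <= 1 ->
  ((if `[< fdom X (dilation t f) >] then (fnorm X (dilation t f))%:E else +oo) <= M)%E.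
  by move=> Xf fn; apply: ereal_sup_ubound; exists f.
have n0 : fnorm X (fun=> 0) = 0.
  by apply/(Xn_eq0 _ X0); exact: ae_onW.
have M0 : (0 <= M)%E.
  apply: le_trans (M_ub _ X0 _); last by rewrite n0 ler01.
  by case: asboolP => [/Xn0|_]; rewrite ?lee_fin// leey.
have M1 : (M < 1)%E.
  rewrite lt_neqAle (operator_norm_le1 k sX) andbT; apply/eqP => ME.
  have := hd t t0 kd; rewrite /boyd_ratio -/M ME lne1 oppe0 inve0 gt0_muley ?ltxx//.
  by rewrite lte_fin oppr_gt0 ln_lt0// t0.
have Mfin : M \is a fin_num by rewrite ge0_fin_numE// (lt_trans M1)// ltry.
exists t, (fine M); split.
- by rewrite t0.
- by rewrite fine_ge0//= -lte_fin fineK.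
have small f : fdom X f -> fnorm X f <= 1 ->
    fdom X (dilation t f) /\ fnorm X (dilation t f) <= fine M.
  move=> Xf /(M_ub _ Xf); case: asboolP => [Xd h|_].
    by split=> //; rewrite -lee_fin fineK.
  by rewrite leye_eq => /eqP Moo; rewrite Moo in Mfin.
move=> f Xf.
(* Dividing by the norm plus e includes the functions of norm 0. *)
have scaled e : 0 < e -> fdom X (dilation t f) /\
    fnorm X (dilation t f) <= fine M * (fnorm X f + e).
  move=> e0; set c := fnorm X f + e.
  have c0 : 0 < c by rewrite ltr_wpDl ?Xn0.
  have [|Xd Xdn] := small (fun x => c^-1 * f x) (XZ _ _ Xf) _.
    rewrite XnZ// ger0_norm ?invr_ge0 ?(ltW c0)// mulrC ler_pdivrMr// mul1r.
    by rewrite lerDl ltW.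
  have dE : dilation t f = fun x => c * dilation t (fun x => c^-1 * f x) x.
    by apply/funext => x; rewrite /dilation mulrA divff ?gt_eqF// mul1r.
  rewrite dE; split; first exact: XZ.
  by rewrite XnZ// ger0_norm ?(ltW c0)// mulrC ler_wpM2r// ltW.
split; first by have [] := scaled 1 ltr01.
apply/ler_addgt0Pr => e e0; have [_ /le_trans] := scaled e e0; apply.
rewrite mulrDr lerD2l; apply: ler_piMl; first exact: ltW.
by rewrite ltW// -lte_fin fineK.
Qed.

Lemma indic_equimeasurable A B : A `<=` Ioo -> B `<=` Ioo -> leb A = leb B ->
  equimeasurable Ioo (\1_A : R -> R) (\1_B : R -> R).
Proof.
have lvl (C : set R) s : C `<=` Ioo -> 0 < s ->
    Ioo `&` [set x | s < `|\1_C x : R|] = if s < 1 then C else set0.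
  move=> CI s0; apply/seteqP; split=> x.
    move=> [Ix] /=; rewrite indicE; case: (boolP (x \in C)) => [/set_mem Cx|_] /=.
      by rewrite normr1 => ->.
    by rewrite normr0 ltNge ltW.
  case: ifP => // s1 Cx; split; first exact: CI.
  by rewrite /= indicE mem_set//= normr1.
move=> AI BI AB s s0; rewrite lvl// lvl//; by case: ifP.
Qed.

(** The tail 1/x is bounded below by 1/2 on ]1, 2], an interval of the same
    length as [0, 1]. *)
Lemma indic01_dom X : banach_function_space Ioo X -> hypothesis_H Ioo X ->
  symmetric_space Ioo X -> fdom X (\1_(`[0, 1]%classic : set R) : R -> R).
Proof.
move=> bX hX [_ symX]; have [_ XZ _ Xi] := banach_normed_ideal bX.
have Xt := tail1_dom bX hX.
have X12 : fdom X (\1_(`]1, 2]%classic : set R) : R -> R).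
  apply: (Xi _ _ _ (XZ 2 _ Xt) _).1.
    exact: L0_indic (itv_Lmeasurable _).
  apply: ae_onW => x _; rewrite indicE.
  case: (boolP (x \in _)) => [/set_mem|_]; last by rewrite normr0.
  rewrite /= in_itv/= => /andP[x1 x2]; rewrite inv_tail_gt// normr1 ger0_norm.
    by rewrite ler_pdivlMr; lra.
  by rewrite divr_ge0// (le_trans ler01)// ltW.
apply: (symX _ _ _ _ _ X12).1; try exact: L0_indic (itv_Lmeasurable _).
apply: indic_equimeasurable.
- by move=> x; rewrite IooE /= in_itv/= => /andP[x1 _]; rewrite (le_trans ler01)// ltW.
- by move=> x; rewrite IooE /= in_itv/= => /andP[].
- have -> : leb (`[0, 1]%classic : set R) = (1 - 0)%:E by exact: leb_itv_bnd.
  have le12 : 1 <= 2 :> R by lra.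
  rewrite (leb_itv_bnd false false le12); congr EFin; lra.
Qed.

(** Partial sums of a staircase with infinitely many steps of height 1
    accumulating at 1; its limit grows like ln (1 / (1 - x)). *)
Definition steps (t : R) (n : nat) : R -> R :=
  fun x => \sum_(k < n) \1_(`[(1 - t ^+ k), 1]%classic : set R) x.

Lemma steps_full t n x : 0 < t -> t < 1 -> 1 - t ^+ n <= x -> x <= 1 ->
  steps t n.+1 x = n.+1%:R.
Proof.
move=> t0 t1 nx x1; rewrite /steps.
rewrite (eq_bigr (fun=> 1)); first by rewrite sumr_const card_ord.
move=> k _; rewrite indicE mem_set//= in_itv/= x1 andbT; apply: le_trans nx.
by rewrite lerD2l lerN2; apply: ler_wiXn2l; rewrite ?ltW// -ltnS.
Qed.

Lemma stepsS t n x : steps t n.+1 x =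
  steps t n x + \1_(`[(1 - t ^+ n), 1]%classic : set R) x.
Proof. by rewrite /steps big_ord_recr. Qed.

Lemma steps_le t m n x : (m <= n)%N -> steps t m x <= steps t n x.
Proof.
move=> /subnK <-; elim: (n - m)%N => [|p IH] //.
by rewrite addSn stepsS (le_trans IH)// lerDl indicE ler0n.
Qed.

(** The n-th step is equimeasurable with the n-fold dilation by t of the
    indicator of [0, 1], so the steps are summable in norm and the partial sums
    have a limit g in X.  As the partial sums increase, the positive part of
    each one minus g has arbitrarily small norm, hence g dominates them. *)
Lemma symmetric_majorant X t r : symmetric_space Ioo X ->
  fdom X (\1_(`[0, 1]%classic : set R) : R -> R) ->
  0 < t -> t < 1 -> 0 <= r -> r < 1 ->
  (forall f, fdom X f -> fdom X (dilation t f) /\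
      fnorm X (dilation t f) <= r * fnorm X f) ->
  exists2 g, fdom X g & ae_on Ioo (fun x => forall n, steps t n x <= g x).
Proof.
move=> [bX symX] X1 t0 t1 r0 r1 hr.
have [XL0 [X0 XD XZ] [[Xn0 Xn_eq0 XnZ XnD] Xc] Xi _] := bX.
pose chi n : R -> R := \1_(`[0, t ^+ n]%classic : set R).
pose psi n : R -> R := \1_(`[(1 - t ^+ n), 1]%classic : set R).
set C := fnorm X (\1_(`[0, 1]%classic : set R) : R -> R).
have tn n : 0 < t ^+ n <= 1 by rewrite exprn_gt0//= exprn_ile1// ltW.
have chi_dom n : fdom X (chi n) /\ fnorm X (chi n) <= C * r ^+ n.
  elim: n => [|n [Xn Xnn]]; first by rewrite expr0 mulr1 /chi expr0.
  have -> : chi n.+1 = dilation t (chi n).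
    apply/funext => x; rewrite /chi /dilation !indicE; congr (_%:R); congr (nat_of_bool _).
    apply/idP/idP => /set_mem; rewrite /= in_itv/= => /andP[x0 xn]; apply/mem_set;
      rewrite /= in_itv/=.
      by rewrite divr_ge0 ?(ltW t0)//= ler_pdivrMr// -exprSr.
    move: x0 xn; rewrite ler_pdivlMr// mul0r ler_pdivrMr// -exprSr => -> ->//.
  have [Xd Xdn] := hr _ Xn; split=> //; apply: le_trans Xdn _.
  by rewrite exprS mulrCA ler_wpM2l.
have psi_dom n : fdom X (psi n) /\ fnorm X (psi n) <= C * r ^+ n.
  have [Xn Xnn] := chi_dom n; have /andP[n0 n1] := tn n.
  have [|||Xp ->] := symX (chi n) (psi n) _ _ _ Xn => //.
  - exact: L0_indic (itv_Lmeasurable _).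
  - exact: L0_indic (itv_Lmeasurable _).
  - apply: indic_equimeasurable.
    + by move=> x; rewrite IooE /= in_itv/= => /andP[].
    + move=> x; rewrite IooE /= in_itv/= => /andP[+ _]; apply: le_trans.
      by rewrite subr_ge0.
    + rewrite (leb_itv_bnd true false (ltW n0)) leb_itv_bnd ?gerBl ?(ltW n0)//.
      by congr EFin; lra.
have G_dom n : fdom X (steps t n).
  elim: n => [|n IH].
    by have -> : steps t 0 = fun=> 0 by apply/funext => x; rewrite /steps big_ord0.
  have -> : steps t n.+1 = fun x => steps t n x + psi n x.
    by apply/funext => x; rewrite stepsS.
  by apply: XD => //; have [] := psi_dom n.
have XB f g : fdom X f -> fdom X g -> fdom X (fun x => f x - g x).
  move=> Xf /(XZ (-1)) /(XD _ _ Xf); congr (fdom X _).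
  by apply/funext => x; rewrite mulN1r.
have XnB f g : fdom X f -> fdom X g ->
    fnorm X (fun x => f x - g x) = fnorm X (fun x => g x - f x).
  move=> Xf Xg; have := XnZ (-1) _ (XB _ _ Xg Xf); rewrite normrN1 mul1r => <-.
  by congr (fnorm X _); apply/funext => x; rewrite mulN1r opprB.
have C0 : 0 <= C by exact: Xn0.
(* The geometric series of ratio r, in telescoping form. *)
pose D := C / (1 - r).
have D0 : 0 <= D by rewrite divr_ge0// subr_ge0 ltW.
have G_diff n p : fnorm X (fun x => steps t (p + n) x - steps t n x) <=
    D * (r ^+ n - r ^+ (p + n)).
  elim: p => [|p IH].
    rewrite !subrr mulr0 (_ : (fun x => _) = fun=> 0).
      by rewrite le_eqVlt (Xn_eq0 _ X0).2 ?eqxx//; exact: ae_onW.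
    by apply/funext => x; rewrite subrr.
  have -> : (fun x => steps t (p.+1 + n) x - steps t n x) =
      fun x => (steps t (p + n) x - steps t n x) + psi (p + n)%N x.
    by apply/funext => x; rewrite addSn stepsS addrAC.
  have [Xp Xpn] := psi_dom (p + n)%N.
  apply: le_trans (XnD _ _ (XB _ _ (G_dom _) (G_dom _)) Xp) _.
  apply: le_trans (lerD IH Xpn) _.
  have -> : C = D * (1 - r) by rewrite /D mulfVK// subr_eq0 gt_eqF.
  rewrite -mulrA -mulrDr; apply: ler_wpM2l => //.
  rewrite addSn exprS; lra.
have G_close N m n : (N <= m)%N -> (N <= n)%N ->
    fnorm X (fun x => steps t m x - steps t n x) <= D * r ^+ N.
  wlog nm : m n / (n <= m)%N => [hw Nm Nn|Nm Nn].
    have [nm|mn] := leqP n m; first exact: hw.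
    by rewrite XnB//; apply: hw => //; exact: ltnW.
  rewrite -(subnK nm); apply: le_trans (G_diff _ _) _.
  apply: ler_wpM2l => //; apply: le_trans (_ : r ^+ n <= _).
    by rewrite gerBl exprn_ge0.
  by apply: ler_wiXn2l => //; exact: ltW.
have [g Xg gG] : exists2 g, fdom X g &
    (fun n => fnorm X (fun x => steps t n x - g x)) @ \oo --> (0 : R).
  apply: Xc => // e e0.
  have De0 : 0 < e / (D + 1) by rewrite divr_gt0// ltr_wpDl.
  have [N hN] : exists N, r ^+ N < e / (D + 1).
    have /cvgrPdist_lt/(_ _ De0)[N _ hN] : r ^+ n @[n --> \oo] --> 0.
      by apply: cvg_expr; rewrite ger0_norm.
    by exists N; have := hN N (leqnn N); rewrite sub0r normrN ger0_norm// exprn_ge0.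
  exists N => m n Nm Nn; apply: le_lt_trans (G_close N m n Nm Nn) _.
  move: hN; rewrite ltr_pdivlMr ?ltr_wpDl// mulrDr mulr1 mulrC; apply: le_lt_trans.
  by rewrite lerDl exprn_ge0.
exists g => //; apply: ae_on_forall => M.
pose p x := Num.max 0 (steps t M x - g x).
have mp : L0 Ioo p.
  by apply: measurable_maxr; [exact: L0_cst|exact: (XL0 _ (XB _ _ (G_dom M) Xg))].
have p_le n : (M <= n)%N -> fdom X p /\ fnorm X p <= fnorm X (fun x => steps t n x - g x).
  move=> Mn; apply: Xi => //; first exact: XB.
  apply: ae_onW => x _; rewrite /p ger0_norm ?le_max ?lexx//.
  rewrite ge_max normr_ge0/=; apply: le_trans (ler_norm _).
  by rewrite lerD2r steps_le.
have Xp : fdom X p := (p_le M (leqnn M)).1.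
have p0 : fnorm X p = 0.
  apply/eqP; rewrite eq_le Xn0// andbT; apply/ler_addgt0Pr => e e0; rewrite add0r.
  move/cvgrPdist_lt : gG => /(_ e e0)[N _ hN].
  have := hN (maxn M N) (leq_maxr _ _); rewrite /= sub0r normrN => h.
  apply: le_trans (p_le _ (leq_maxl M N)).2 _; apply: ltW; apply: le_lt_trans h.
  exact: ler_norm.
apply: ae_onS ((Xn_eq0 _ Xp).1 p0) => x _ px.
by rewrite -subr_le0 -px /p le_max lexx orbT.
Qed.

(** With n such that 1 - t^n <= x < 1 - t^(n+1), the integral of the pole over
    [0, x] is at most (n + 1) (1/t - 1), and 1/x <= 1 / (1 - t) unless n = 0,
    where the pole itself is at most 1/t on [0, x]. *)
Lemma pole_cesaro_le t x : 0 < t -> t < 1 -> 0 < x -> x < 1 ->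
  exists n : nat, [/\ 1 - t ^+ n <= x &
    (cesaro_op (fun u => `|pole u|%R) x <= (t^-1 * n.+1%:R)%:E)%E].
Proof.
move=> t0 t1 x0 x1.
have hex : exists m, t ^+ m < 1 - x by apply: expr_small; rewrite ?subr_gt0.
case: (ex_minnP hex) => -[|n] hm min_m.
  by move: hm; rewrite expr0 ltrBrDl -ltrBrDr subrr ltNge ltW.
exists n.
have nx : 1 - t ^+ n <= x.
  rewrite leNgt; apply/negP => xn; suff : (n.+1 <= n)%N by rewrite ltnn.
  by apply: min_m; rewrite ltrBrDr -ltrBrDl.
split=> //; rewrite cesaro_absE lee_pdivrMl//.
have sub : `[0, x]%classic `<=` (I01 : set R).
  by move=> y; rewrite I01E /= in_itv/= => /andP[-> /le_trans->//]; exact: ltW.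
case: n nx hm {min_m} => [_ hm|n nx hm].
  have bnds y : 0 <= y -> y <= x -> 0 <= pole y <= t^-1.
    move=> y0 yx; rewrite (ltW (pole_gt0 (le_lt_trans yx x1)))/=.
    apply: le_trans (pole_le yx x1) _; rewrite /pole lef_pV2 ?posrE ?subr_gt0//.
    by apply: ltW; move: hm; rewrite expr1.
  have := @absint_itv_bounds R 0 x 0 t^-1 true false pole (ltW x0)
    (L0S I01_Lmeasurable sub L0_pole) (lexx 0) bnds.
  by rewrite subr0 mulr1 -EFinM => /andP[_]; rewrite mulrC.
have /andP[_ h] := pole_integral_bounds n.+2 t0 t1.
apply: (@le_trans _ _ (absint `[0%R, (1 - t ^+ n.+2)%R]%classic pole)).
  apply: absint_subset; try exact: itv_Lmeasurable.
    move=> y; rewrite /= !in_itv/= => /andP[-> yx]; rewrite (le_trans yx)//.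
    by rewrite lerBrDr -lerBrDl ltW.
  apply: L0S I01_Lmeasurable _ (L0_pole) => y; rewrite I01E /= in_itv/= => /andP[-> /le_trans->//].
  by rewrite gerBl exprn_ge0// ltW.
apply: le_trans h _; rewrite lee_fin.
have tx : 1 - t <= x.
  apply: le_trans nx; rewrite lerD2l lerN2 exprS; apply: ler_piMr; first exact: ltW.
  by rewrite exprn_ile1// ltW.
rewrite mulrC mulrA; apply: ler_wpM2r => //.
apply: (@le_trans _ _ ((1 - t) / t)); last first.
  by rewrite ler_wpM2r// invr_ge0 ltW.
by rewrite mulrBl mul1r divff// gt_eqF.
Qed.

(** The witness is the pole: its Cesaro mean is dominated by the staircase, but
    the larger space on the half-line contains only integrable functions. *)
Theorem cesaro_truncation_not_sub X (q : \bar R) : banach_function_space Ioo X ->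
  hypothesis_H Ioo X -> symmetric_space Ioo X ->
  is_upper_boyd_index X q -> (q < +oo)%E ->
  ~ (fdom (cesaro_space I01 (truncation01 I01 X)) `<=`
       fdom (truncation01 I01 (cesaro_space Ioo X))).
Proof.
move=> bX hX sX hq qoo sub.
have std01 : (I01 : set R) = I01 \/ (I01 : set R) = Ioo by left.
have [t [r [/andP[t0 t1] /andP[r0 r1] hr]]] := strict_dilation sX hq qoo.
have [g Xg gS] := symmetric_majorant sX (indic01_dom bX hX sX) t0 t1 r0 r1 hr.
have [_ XZ _ Xi] := banach_normed_ideal bX.
pose h := (fine \o cesaro_op (fun u => `|pole u : R|)) \_ I01.
have ti0 : 0 <= t^-1 by rewrite invr_ge0 ltW.
have good x : I01 x -> x <> 0 -> x <> 1 -> 0 < x < 1.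
  by rewrite I01E !lt_neqAle => /andP[-> ->] /eqP x0 /eqP x1; rewrite eq_sym x0 x1.
have Xh : fdom X h.
  apply: (Xi _ _ _ (XZ t^-1 _ Xg) _).1.
    by apply/L0_restrict01; exact: (L0_fine_cesaro std01 (L0_norm (L0_pole))).
  apply: ae_onS2 (ae_onS2 _ gS (ae_on_neq Ioo 0)) (ae_on_neq Ioo 1); last first.
    by move=> x _ gx x0; exact: (conj gx x0).
  move=> x _ [gx x0] x1; have [Ix|Ix] := pselect (I01 x); last first.
    by rewrite /h restrict01_out// normr0.
  have /andP[{}x0 {}x1] := good x Ix x0 x1.
  have [n [nx Cx]] := pole_cesaro_le t0 t1 x0 x1.
  rewrite /h restrict01// ger0_norm; last by apply: cesaro_fine_ge0; exact: ltW.
  apply: (@le_trans _ _ (t^-1 * n.+1%:R)).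
    rewrite /= -lee_fin fineK// ge0_fin_numE; first by rewrite (le_lt_trans Cx) ?ltry.
    by rewrite cesaro_absE mule_ge0 ?absint_ge0// lee_fin invr_ge0 ltW.
  apply: le_trans (ler_norm _); rewrite ler_wpM2l//.
  by rewrite -(steps_full t0 t1 nx (ltW x1)).
have /sub Tp : fdom (cesaro_space I01 (truncation01 I01 X)) pole.
  split; first exact: L0_pole.
  split; last exact/truncation01_dom.
  apply: (ae_onS2 _ (ae_on_neq I01 0) (ae_on_neq I01 1)) => x Ix x0 x1.
  have /andP[{}x0 {}x1] := good x Ix x0 x1.
  have [n [_ Cx]] := pole_cesaro_le t0 t1 x0 x1.
  rewrite ge0_fin_numE; first by rewrite (le_lt_trans Cx) ?ltry.
  by rewrite cesaro_absE mule_ge0 ?absint_ge0// lee_fin invr_ge0 ltW.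
have [K _ /(_ _ Tp)[]] := cesaro_truncation_L1 bX.
by rewrite pole_not_integrable.
Qed.

End FiniteBoydIndex.

(** * The theorem *)

Theorem lemma5p1 (R : realType) :
  (forall (I : set R) (X : fspace R), I = I01 \/ I = Ioo ->
     banach_function_space I X -> hypothesis_H I X ->
     forall lambda : R, 0 < lambda -> (lambda%:E < leb I)%E ->
     embeds (truncation I `[0, lambda]%classic (cesaro_space I X))
            (truncation I `[0, lambda]%classic (L1space I))) /\
  (exists X : fspace R,
     [/\ banach_function_space I01 X, hypothesis_H I01 X &
         ~ embeds (cesaro_space I01 X) (L1space I01)]) /\
  (exists X : fspace R,
     [/\ banach_function_space Ioo X, hypothesis_H Ioo X &
         ~ embeds (cesaro_space Ioo X) (L1space Ioo)]) /\
  (forall X : fspace R,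
     banach_function_space Ioo X -> hypothesis_H Ioo X ->
     same_space (truncation01 I01 (cesaro_space Ioo X))
                (fspaceI (cesaro_space I01 (truncation01 I01 X))
                         (L1space I01)) /\
     (forall lambda : R, 0 < lambda -> lambda < 1 ->
        same_space
          (truncation01 `[0, lambda]%classic (cesaro_space Ioo X))
          (truncation I01 `[0, lambda]%classic
             (cesaro_space I01 (truncation01 I01 X))))) /\
  (forall (X : fspace R) (q : \bar R),
     banach_function_space Ioo X -> hypothesis_H Ioo X ->
     symmetric_space Ioo X ->
     is_upper_boyd_index X q -> (q < +oo)%E ->
     fdom (cesaro_space I01 (truncation01 I01 X)) <>
       fdom (truncation01 I01 (cesaro_space Ioo X)) /\
     ~ (fdom (cesaro_space I01 (truncation01 I01 X)) `<=`
          fdom (truncation01 I01 (cesaro_space Ioo X)))).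
Proof.
split.
  by move=> I X hI bX _; exact: cesaro_truncation_embeds_L1.
split; first exact: I01_counterexample.
split; first exact: Ioo_counterexample.
split=> [X bX hX|X q bX hX sX hq qoo].
  split; first exact: cesaro_truncation_inter.
  by move=> lambda; exact: cesaro_truncation_lt1.
have nsub := cesaro_truncation_not_sub bX hX sX hq qoo.
by split=> // domE; apply: nsub; rewrite domE.
Qed.
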